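(* Let $R$ be a commutative noetherian reduced ring with normalization $\widetilde{R}$, and let $M$ be a finitely generated, faithful, torsion-free $R$-module that gives a noncommutative crepant resolution (NCCR) of $R$. Then $$\operatorname{End}_R(M) \cong \operatorname{End}_{\widetilde R}(F(M)),$$ where $F(M)=(M \otimes_R \widetilde{R})^{**}$ and $N^*=\operatorname{Hom}_{\widetilde{R}}(N,\widetilde{R})$ for an $\widetilde R$-module $N$.
   Context: The normalization $\widetilde R$ of $R$ is its integral closure in its total quotient ring. $A$ is a non-singular $R$-order if $A$ is a maximal Cohen--Macaulay $R$-module and $\operatorname{gldim} A_{\mathfrak p} = \dim R_{\mathfrak p}$ for all $\mathfrak p \in \operatorname{Spec} R$. A finitely generated torsion-free $R$-module $M$ with $\operatorname{supp} M = \operatorname{supp} R$ gives a NCCR of $R$ if $A=\operatorname{End}_R(M)$ is a non-singular $R$-order. *)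

(* Defs.v *)
From HB Require Import structures.
From mathcomp Require Import all_boot all_algebra.
From mathcomp Require Import boolp classical_sets.
From mathcomp Require Import ring.

Set Implicit Arguments.
Unset Strict Implicit.
Unset Printing Implicit Defensive.

Import GRing.Theory.

Local Open Scope ring_scope.
Local Open Scope quotient_scope.
Local Open Scope classical_set_scope.

(* The zero ring is allowed throughout ([comPzRingType], [pzRingType]): the
   endomorphism ring of a zero module is one.  The library's [algType] requires
   1 != 0, and no structure there joins [pzRingType] and [lmodType R], whence
   the following record. *)
Record algebra (R : comPzRingType) := Algebra {
  alg_mod :> lmodType R;
  alg_one : alg_mod;
  alg_mul : alg_mod -> alg_mod -> alg_mod;
  alg_mulA : associative alg_mul;
  alg_mul1l : left_id alg_one alg_mul;
  alg_mul1r : right_id alg_one alg_mul;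
  alg_mulDl : left_distributive alg_mul +%R;
  alg_mulDr : right_distributive alg_mul +%R;
  alg_scaleAl : forall (a : R) x y, a *: alg_mul x y = alg_mul (a *: x) y;
  alg_scaleAr : forall (a : R) x y, a *: alg_mul x y = alg_mul x (a *: y)
}.

Definition regular_alg (R : comPzRingType) : algebra R :=
  @Algebra R R^o 1 *%R (@mulrA R) (@mul1r R) (@mulr1 R) (@mulrDl R) (@mulrDr R)
    (@mulrA R) (@mulrCA R).

Section Hom.
Variables (R : comPzRingType) (U V : lmodType R).

Definition Hom := {linear U -> V}.
Identity Coercion Hom_to_linear : Hom >-> GRing.Linear.type.

HB.instance Definition _ := gen_eqMixin Hom.
HB.instance Definition _ := gen_choiceMixin Hom.

Implicit Types f g h : Hom.

Lemma HomP f g : f =1 g -> f = g.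
Proof.
case: f g => [f [[cf1] [cf2]]] [g [[cg1] [cg2]]] /= /funext fg.
by subst g; congr GRing.Linear.Pack; congr GRing.Linear.Class;
  [congr Algebra.isNmodMorphism.Axioms_|congr GRing.isScalable.Axioms_];
  exact: Prop_irrelevance.
Qed.

Definition Hom0 : Hom := (\0 : {linear U -> V}).
Definition Hom_add f g : Hom := (f \+ g : {linear U -> V}).
Definition Hom_opp f : Hom := (\- f : {linear U -> V}).
Definition Hom_scale (a : R) f : Hom := (a \*: f : {linear U -> V}).

Lemma Hom_addA : associative Hom_add.
Proof. by move=> f g h; apply: HomP => x /=; rewrite addrA. Qed.
Lemma Hom_addC : commutative Hom_add.
Proof. by move=> f g; apply: HomP => x /=; rewrite addrC. Qed.
Lemma Hom_add0 : left_id Hom0 Hom_add.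
Proof. by move=> f; apply: HomP => x /=; rewrite add0r. Qed.
Lemma Hom_addN : left_inverse Hom0 Hom_opp Hom_add.
Proof. by move=> f; apply: HomP => x /=; rewrite addNr. Qed.

HB.instance Definition _ :=
  GRing.isZmodule.Build Hom Hom_addA Hom_addC Hom_add0 Hom_addN.

Lemma Hom_scaleA a b f : Hom_scale a (Hom_scale b f) = Hom_scale (a * b) f.
Proof. by apply: HomP => x /=; rewrite scalerA. Qed.
Lemma Hom_scale1 : left_id 1 Hom_scale.
Proof. by move=> f; apply: HomP => x /=; rewrite scale1r. Qed.
Lemma Hom_scaleDr : right_distributive Hom_scale +%R.
Proof. by move=> a f g; apply: HomP => x /=; rewrite scalerDr. Qed.
Lemma Hom_scaleDl f : {morph Hom_scale^~ f : a b / a + b}.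
Proof. by move=> a b; apply: HomP => x /=; rewrite scalerDl. Qed.

HB.instance Definition _ := GRing.Zmodule_isLmodule.Build R Hom
  Hom_scaleA Hom_scale1 Hom_scaleDr Hom_scaleDl.
End Hom.

Section End.
Variables (R : comPzRingType) (M : lmodType R).

Definition End := Hom M M.
Identity Coercion End_to_Hom : End >-> Hom.

HB.instance Definition _ := GRing.Lmodule.on End.

Implicit Types f g h : End.

Definition End_one : End := (idfun : {linear M -> M}).
Definition End_mul f g : End := (f \o g : {linear M -> M}).

Lemma End_mulA : associative End_mul.
Proof. by move=> f g h; apply: HomP. Qed.
Lemma End_mul1l : left_id End_one End_mul.
Proof. by move=> f; apply: HomP. Qed.
Lemma End_mul1r : right_id End_one End_mul.
Proof. by move=> f; apply: HomP. Qed.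
Lemma End_mulDl : left_distributive End_mul +%R.
Proof. by move=> f g h; apply: HomP. Qed.
Lemma End_mulDr : right_distributive End_mul +%R.
Proof. by move=> f g h; apply: HomP => x /=; rewrite linearD. Qed.

HB.instance Definition _ := GRing.Zmodule_isPzRing.Build End
  End_mulA End_mul1l End_mul1r End_mulDl End_mulDr.

Lemma End_scalerAl (a : R) f g : a *: (f * g) = (a *: f) * g.
Proof. by apply: HomP. Qed.
Lemma End_scalerAr (a : R) f g : a *: (f * g) = f * (a *: g).
Proof. by apply: HomP => x /=; rewrite linearZ. Qed.

Definition End_alg : algebra R :=
  Algebra End_mulA End_mul1l End_mul1r End_mulDl End_mulDr
    End_scalerAl End_scalerAr.
End End.

Record mulset (R : comPzRingType) := MulSet {
  mulset_set :> set R;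
  mulset1 : mulset_set 1;
  mulsetM : forall s t, mulset_set s -> mulset_set t -> mulset_set (s * t)
}.

Section Localization.
Variables (R : comPzRingType) (S : mulset R).

Lemma mulset1_subproof : (1 : R) \in (S : set R).
Proof. by rewrite inE; exact: mulset1. Qed.
Lemma mulsetM_subproof (s t : S) : sval s * sval t \in (S : set R).
Proof.
case: s t => [s Ss] [t St] /=; rewrite inE.
by apply: mulsetM; [exact: set_mem Ss | exact: set_mem St].
Qed.

Definition denom1 : S := 
  exist (fun x => x \in (S : set R)) 1 mulset1_subproof.
Definition denomM (s t : S) : S := 
  exist (fun x => x \in (S : set R)) _ (mulsetM_subproof s t).

Section Module.
Variable M : lmodType R.

Definition loc_rel (x y : M * S) : bool :=
  `[< exists u : S, sval u *: (sval y.2 *: x.1) = sval u *: (sval x.2 *: y.1) >].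

Lemma loc_rel_equiv : equiv_class_of loc_rel.
Proof.
split=> [x|x y|y x z]; first by apply/asboolP; exists denom1.
  by apply/asboolP/asboolP => -[u e]; exists u.
move=> /asboolP[u e1] /asboolP[v e2]; apply/asboolP.
exists (denomM (denomM u v) y.2) => /=.
have -> : (sval u * sval v * sval y.2) *: (sval z.2 *: x.1) =
    (sval v * sval z.2) *: (sval u *: (sval y.2 *: x.1)).
  by rewrite !scalerA; congr (_ *: _); ring.
have -> : (sval u * sval v * sval y.2) *: (sval x.2 *: z.1) =
    (sval u * sval x.2) *: (sval v *: (sval y.2 *: z.1)).
  by rewrite !scalerA; congr (_ *: _); ring.
by rewrite e1 -e2 !scalerA; congr (_ *: _); ring.
Qed.

Canonical loc_equiv := EquivRelPack loc_rel_equiv.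

Definition loc := {eq_quot loc_rel}.
HB.instance Definition _ := EqQuotient.on loc.
HB.instance Definition _ := Choice.on loc.

Definition frac (m : M) (s : S) : loc := \pi_loc (m, s).

Lemma fracP m s n t :
  frac m s = frac n t <->
  exists u : S, sval u *: (sval t *: m) = sval u *: (sval s *: n).
Proof.
split; first by move=> /eqmodP /asboolP.
by move=> h; apply/eqmodP/asboolP.
Qed.

Lemma locW (P : loc -> Prop) : (forall m s, P (frac m s)) -> forall x, P x.
Proof. by move=> h; elim/quotW => -[m s]; exact: h. Qed.

Lemma frac_repr (x : loc) : frac (repr x).1 (repr x).2 = x.
Proof. by rewrite /frac -surjective_pairing reprK. Qed.

Lemma frac_eq m s n t : sval t *: m = sval s *: n -> frac m s = frac n t.
Proof. by move=> e; apply/fracP; exists denom1; rewrite e. Qed.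

Definition loc_zero : loc := frac 0 denom1.
Definition loc_opp (x : loc) : loc := frac (- (repr x).1) (repr x).2.
Definition loc_add (x y : loc) : loc :=
  frac (sval (repr y).2 *: (repr x).1 + sval (repr x).2 *: (repr y).1)
       (denomM (repr x).2 (repr y).2).

Lemma loc_oppE m s : loc_opp (frac m s) = frac (- m) s.
Proof.
rewrite /loc_opp; have := frac_repr (frac m s).
move: (repr _) => [m' s'] /= /fracP[u e]; apply/fracP; exists u.
by rewrite !scalerN e.
Qed.

Lemma loc_addE m s n t :
  loc_add (frac m s) (frac n t) =
  frac (sval t *: m + sval s *: n) (denomM s t).
Proof.
rewrite /loc_add.
have := frac_repr (frac m s); have := frac_repr (frac n t).
move: (repr (frac m s)) (repr (frac n t)) => [m' s'] [n' t'] /=.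
move=> /fracP[v e2] /fracP[u e1]; apply/fracP; exists (denomM u v) => /=.
rewrite !scalerDr; congr (_ + _).
  transitivity ((sval v * sval t' * sval t) *: (sval u *: (sval s *: m'))).
    by rewrite !scalerA; congr (_ *: _); ring.
  by rewrite e1 !scalerA; congr (_ *: _); ring.
transitivity ((sval u * sval s' * sval s) *: (sval v *: (sval t *: n'))).
  by rewrite !scalerA; congr (_ *: _); ring.
by rewrite e2 !scalerA; congr (_ *: _); ring.
Qed.

Lemma loc_addA : associative loc_add.
Proof.
elim/locW=> m s; elim/locW=> n t; elim/locW=> k u; rewrite !loc_addE.
apply: frac_eq => /=; rewrite !scalerDr !scalerA addrA.
by congr (_ *: _ + _ *: _ + _ *: _); ring.
Qed.

Lemma loc_addC : commutative loc_add.
Proof.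
elim/locW=> m s; elim/locW=> n t; rewrite !loc_addE.
apply: frac_eq => /=; rewrite !scalerDr !scalerA addrC.
by congr (_ *: _ + _ *: _); ring.
Qed.

Lemma loc_add0 : left_id loc_zero loc_add.
Proof.
elim/locW=> n t; rewrite !loc_addE.
by apply: frac_eq => /=; rewrite scaler0 add0r scale1r mul1r.
Qed.

Lemma loc_addN : left_inverse loc_zero loc_opp loc_add.
Proof.
elim/locW=> n t; rewrite loc_oppE loc_addE.
by apply: frac_eq => /=; rewrite -scalerDr addNr !scaler0.
Qed.

HB.instance Definition _ :=
  GRing.isZmodule.Build loc loc_addA loc_addC loc_add0 loc_addN.

Lemma fracD m s n t :
  frac m s + frac n t = frac (sval t *: m + sval s *: n) (denomM s t).
Proof. exact: loc_addE. Qed.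
End Module.

Section Algebra.
Variable A : algebra R.

Definition loc_one : loc A := frac (alg_one A) denom1.
Definition loc_mul (x y : loc A) : loc A :=
  frac (alg_mul (repr x).1 (repr y).1) (denomM (repr x).2 (repr y).2).

Lemma loc_mulE (a b : A) s t :
  loc_mul (frac a s) (frac b t) = frac (alg_mul a b) (denomM s t).
Proof.
rewrite /loc_mul.
have := frac_repr (frac a s); have := frac_repr (frac b t).
move: (repr (frac a s)) (repr (frac b t)) => [a' s'] [b' t'] /=.
move=> /fracP[v e2] /fracP[u e1]; apply/fracP; exists (denomM u v) => /=.
transitivity (alg_mul (sval u *: (sval s *: a')) (sval v *: (sval t *: b'))).
  by rewrite -!alg_scaleAl -!alg_scaleAr !scalerA; congr (_ *: _); ring.
rewrite e1 e2 -!alg_scaleAl -!alg_scaleAr !scalerA; congr (_ *: _); ring.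
Qed.

Lemma loc_mulA : associative loc_mul.
Proof.
elim/locW=> a s; elim/locW=> b t; elim/locW=> c u; rewrite !loc_mulE.
by apply: frac_eq => /=; rewrite alg_mulA mulrA.
Qed.

Lemma loc_mul1l : left_id loc_one loc_mul.
Proof.
by elim/locW=> a s; rewrite loc_mulE; apply: frac_eq => /=; rewrite alg_mul1l !mul1r.
Qed.

Lemma loc_mul1r : right_id loc_one loc_mul.
Proof.
by elim/locW=> a s; rewrite loc_mulE; apply: frac_eq => /=; rewrite alg_mul1r !mulr1.
Qed.

Lemma loc_mulDl : left_distributive loc_mul +%R.
Proof.
elim/locW=> a s; elim/locW=> b t; elim/locW=> c u.
rewrite fracD !loc_mulE fracD; apply: frac_eq => /=.
rewrite alg_mulDl -!alg_scaleAl !scalerDr !scalerA.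
by congr (_ *: _ + _ *: _); ring.
Qed.

Lemma loc_mulDr : right_distributive loc_mul +%R.
Proof.
elim/locW=> a s; elim/locW=> b t; elim/locW=> c u.
rewrite fracD !loc_mulE fracD; apply: frac_eq => /=.
rewrite alg_mulDr -!alg_scaleAr !scalerDr !scalerA.
by congr (_ *: _ + _ *: _); ring.
Qed.

Definition loc_alg := loc A.

HB.instance Definition _ := GRing.Zmodule.on loc_alg.
HB.instance Definition _ := GRing.Zmodule_isPzRing.Build loc_alg
  loc_mulA loc_mul1l loc_mul1r loc_mulDl loc_mulDr.

Lemma fracM (a b : A) s t :
  (frac a s : loc_alg) * (frac b t : loc_alg) = frac (alg_mul a b) (denomM s t).
Proof. exact: loc_mulE. Qed.
End Algebra.

Definition loc_ring := loc_alg (regular_alg R).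

HB.instance Definition _ := GRing.PzRing.on loc_ring.

Lemma loc_ring_mulC : commutative (@GRing.mul loc_ring).
Proof.
elim/locW=> a s; elim/locW=> b t; rewrite [LHS]fracM [RHS]fracM.
have -> : alg_mul a b = alg_mul b a by exact: (@mulrC R).
by apply: frac_eq => /=; rewrite [sval t * _]mulrC.
Qed.

HB.instance Definition _ :=
  GRing.PzRing_hasCommutativeMul.Build loc_ring loc_ring_mulC.

Definition rfrac (r : R) (s : S) : loc_ring := @frac R^o r s.

Lemma rfracD r s q t :
  rfrac r s + rfrac q t = rfrac (sval t * r + sval s * q) (denomM s t).
Proof. exact: fracD. Qed.
Lemma rfracM r s q t : rfrac r s * rfrac q t = rfrac (r * q) (denomM s t).
Proof. exact: fracM. Qed.
Lemma rfrac_repr (x : loc_ring) : rfrac (repr x).1 (repr x).2 = x.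
Proof. exact: frac_repr. Qed.
Lemma rfracP r s q t :
  rfrac r s = rfrac q t <->
  exists u : S, sval u * (sval t * r) = sval u * (sval s * q).
Proof. exact: fracP. Qed.
Lemma loc_ringW (P : loc_ring -> Prop) :
  (forall r s, P (rfrac r s)) -> forall x, P x.
Proof. exact: (@locW R^o P). Qed.

Section ScalarAction.
Variable M : lmodType R.

Definition loc_scale (x : loc_ring) (y : loc M) : loc M :=
  frac (((repr x).1 : R) *: (repr y).1) (denomM (repr x).2 (repr y).2).

Lemma loc_scaleE r s m t :
  loc_scale (rfrac r s) (frac m t) = frac (r *: m) (denomM s t).
Proof.
rewrite /loc_scale.
have := rfrac_repr (rfrac r s); have := frac_repr (frac m t).
move: (repr (rfrac r s)) (repr (frac m t)) => [r' s'] [m' t'] /=.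
move=> /fracP[v e2] /rfracP[u e1]; apply/fracP; exists (denomM u v) => /=.
transitivity ((sval u * (sval s * r')) *: (sval v *: (sval t *: m'))).
  by rewrite !scalerA; congr (_ *: _); ring.
by rewrite e1 e2 !scalerA; congr (_ *: _); ring.
Qed.

Lemma loc_scaleA a b x : loc_scale a (loc_scale b x) = loc_scale (a * b) x.
Proof.
move: a b x; elim/loc_ringW=> r s; elim/loc_ringW=> q t; elim/locW=> m u.
rewrite rfracM !loc_scaleE scalerA; apply: frac_eq => /=.
by rewrite mulrA.
Qed.

Lemma loc_scale1 : left_id 1 loc_scale.
Proof.
elim/locW=> m s; rewrite -[1]/(rfrac 1 denom1) loc_scaleE.
by apply: frac_eq => /=; rewrite mul1r scale1r.
Qed.

Lemma loc_scaleDr : right_distributive loc_scale +%R.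
Proof.
elim/loc_ringW=> r s; elim/locW=> m t; elim/locW=> n u.
rewrite fracD !loc_scaleE fracD; apply: frac_eq => /=.
by rewrite !scalerDr !scalerA; congr (_ *: _ + _ *: _); ring.
Qed.

Lemma loc_scaleDl x : {morph loc_scale^~ x : a b / a + b}.
Proof.
move: x; elim/locW=> m u; elim/loc_ringW=> r s; elim/loc_ringW=> q t.
rewrite rfracD !loc_scaleE fracD; apply: frac_eq => /=.
by rewrite !scalerA -scalerDl scalerA; congr (_ *: _); ring.
Qed.

HB.instance Definition _ := GRing.Zmodule_isLmodule.Build loc_ring (loc M)
  loc_scaleA loc_scale1 loc_scaleDr loc_scaleDl.
End ScalarAction.

Definition to_loc_ring (r : R) : loc_ring := rfrac r denom1.

Lemma to_loc_ring_zmod : zmod_morphism to_loc_ring.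
Proof.
move=> r q; rewrite /to_loc_ring [- rfrac q _]loc_oppE rfracD.
by apply/rfracP; exists denom1; rewrite /= !mul1r.
Qed.

Lemma to_loc_ring_monoid : monoid_morphism to_loc_ring.
Proof.
split=> // r q; rewrite /to_loc_ring rfracM.
by apply/rfracP; exists denom1; rewrite /= !mul1r.
Qed.

HB.instance Definition _ :=
  GRing.isZmodMorphism.Build R loc_ring to_loc_ring to_loc_ring_zmod.
HB.instance Definition _ :=
  GRing.isMonoidMorphism.Build R loc_ring to_loc_ring to_loc_ring_monoid.
End Localization.

Definition nonzerodivisor (R : comPzRingType) : set R :=
  [set r | forall x, r * x = 0 -> x = 0].

Section Normalization.
Variable R : comPzRingType.

Lemma nonzerodivisor1 : nonzerodivisor (1 : R).
Proof. by move=> x; rewrite mul1r. Qed.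
Lemma nonzerodivisorM (s t : R) :
  nonzerodivisor s -> nonzerodivisor t -> nonzerodivisor (s * t).
Proof. by move=> hs ht x; rewrite -mulrA => /hs /ht. Qed.

Definition nonzerodivisors := MulSet nonzerodivisor1 nonzerodivisorM.

Definition total_quotient_ring : comPzRingType := loc_ring nonzerodivisors.
End Normalization.

(* The library's [integralOver], written out without [{poly R}], which is only
   available for nontrivial rings. *)
Definition integral_over (R K : comPzRingType) (f : R -> K) (x : K) : Prop :=
  exists (n : nat) (a : 'I_n -> R), x ^+ n + \sum_(i < n) f (a i) * x ^+ i = 0.

Section IntegralSubring.
Variables (R K : comPzRingType) (f : {rmorphism R -> K}).

Lemma integral_over_id r : integral_over f (f r).
Proof.
exists 1, (fun=> - r).
by rewrite big_ord1 expr0 mulr1 expr1 rmorphN subrr.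
Qed.

Lemma integral_over_trivial : (1 : K) = 0 -> forall x, integral_over f x.
Proof. by move=> K0 x; exists 0, (fun=> 0); rewrite big_ord0 expr0 addr0. Qed.
End IntegralSubring.

Lemma integral_overE (R K : comNzRingType) (f : {rmorphism R -> K}) (x : K) :
  integral_over f x <-> integralOver f x.
Proof.
split=> [[n [a e]]|[p mon_p rt_p]].
  pose q : {poly R} := \poly_(i < n) oapp a 0 (insub i).
  have sq : (size q < (size ('X^n : {poly R})))%N.
    by rewrite size_polyXn ltnS size_poly.
  exists ('X^n + q); first by rewrite monicE lead_coefDl // lead_coefXn.
  rewrite rootE rmorphD /= map_polyXn hornerD hornerXn.
  rewrite (_ : (map_poly f q).[x] = \sum_(i < n) f (a i) * x ^+ i) ?e //.
  rewrite (@horner_coef_wide _ n); last first.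
    by rewrite (leq_trans (size_poly _ _))// size_poly.
  apply: eq_bigr => i _; rewrite coef_map coef_poly ltn_ord /=.
  by rewrite valK.
have sp : size p = (size p).-1.+1.
  by rewrite prednK // lt0n size_poly_eq0 monic_neq0.
exists (size p).-1, (fun i => p`_i).
move: rt_p; rewrite rootE => /eqP rt_p; rewrite -[RHS]rt_p.
rewrite (@horner_coef_wide _ (size p).-1.+1); last by rewrite -sp size_poly.
have pl : (map_poly f p)`_(size p).-1 = 1.
  by rewrite coef_map -lead_coefE (monicP mon_p); exact: rmorph1.
rewrite big_ord_recr /= pl mul1r addrC.
by congr (_ + _); apply: eq_bigr => i _; rewrite coef_map.
Qed.

Section IntegralClosure.
Variables (R K : comPzRingType) (f : {rmorphism R -> K}).

Definition integral_closure : {pred K} := [pred x | `[< integral_over f x >]].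

Lemma integral_closure_subring : subring_closed integral_closure.
Proof.
have [/eqP K0|K1] := eqVneq (1 : K) 0.
  by split=> [|x y _ _|x y _ _];
    apply/asboolP/(integral_over_trivial _ (eqP K0)).
have R1 : (1 : R) != 0.
  by apply: contra_neq K1 => R0; rewrite -(rmorph1 f) R0 rmorph0.
pose R' : comNzRingType :=
  HB.pack (R : Type) R (GRing.PzSemiRing_isNonZero.Build R R1).
pose K' : comNzRingType :=
  HB.pack (K : Type) K (GRing.PzSemiRing_isNonZero.Build K K1).
pose f' : {rmorphism R' -> K'} := f.
have E x : x \in integral_closure <-> integralOver f' x.
  by split=> [/asboolP /(integral_overE f')|/(integral_overE f') /asboolP].
split=> [|x y /E xi /E yi|x y /E xi /E yi]; apply/E.
- exact: integral1.
- exact: integral_sub.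
- exact: integral_mul.
Qed.

HB.instance Definition _ :=
  GRing.isSubringClosed.Build K integral_closure integral_closure_subring.
End IntegralClosure.

Section NormalizationRing.
Variable R : comPzRingType.

Let R_to_Q : {rmorphism R -> total_quotient_ring R} :=
  to_loc_ring (nonzerodivisors R).

Record normalization := Normalization {
  normalization_val :> total_quotient_ring R;
  normalizationP : normalization_val \in integral_closure R_to_Q
}.

HB.instance Definition _ := [isSub for normalization_val].
HB.instance Definition _ := [Choice of normalization by <:].
HB.instance Definition _ := GRing.SubChoice_isSubComPzRing.Build
  (total_quotient_ring R) _ normalization (integral_closure_subring R_to_Q).

Lemma to_normalization_subproof r : R_to_Q r \in integral_closure R_to_Q.
Proof. exact/asboolP/integral_over_id. Qed.

Definition to_normalization (r : R) : normalization :=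
  Normalization (to_normalization_subproof r).

Lemma to_normalization_zmod : zmod_morphism to_normalization.
Proof. by move=> r q; apply: val_inj; rewrite raddfB /= rmorphB. Qed.
Lemma to_normalization_monoid : monoid_morphism to_normalization.
Proof.
by split=> [|r q]; apply: val_inj; rewrite ?rmorph1 ?rmorphM //= rmorphM.
Qed.

HB.instance Definition _ := GRing.isZmodMorphism.Build R normalization
  to_normalization to_normalization_zmod.
HB.instance Definition _ := GRing.isMonoidMorphism.Build R normalization
  to_normalization to_normalization_monoid.
End NormalizationRing.

Section ExtensionOfScalars.
Variables (R R' : comPzRingType) (f : {rmorphism R -> R'}) (M : lmodType R).

(* The lists are formal sums of elementary tensors in M (x)_R R'. *)
Inductive tensor_rel : seq (M * R') -> seq (M * R') -> Prop :=
| tensor_refl s : tensor_rel s s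
| tensor_sym s t : tensor_rel s t -> tensor_rel t s
| tensor_trans s t u : tensor_rel s t -> tensor_rel t u -> tensor_rel s u
| tensor_cat s s' t t' :
    tensor_rel s s' -> tensor_rel t t' -> tensor_rel (s ++ t) (s' ++ t')
| tensor_comm s t : tensor_rel (s ++ t) (t ++ s)
| tensor_zero c : tensor_rel [:: (0, c)] [::]
| tensor_addl m n c : tensor_rel [:: (m + n, c)] [:: (m, c); (n, c)]
| tensor_addr m c d : tensor_rel [:: (m, c + d)] [:: (m, c); (m, d)]
| tensor_scale r m c : tensor_rel [:: (r *: m, c)] [:: (m, f r * c)].

Definition tensor_eq s t : bool := `[< tensor_rel s t >].

Lemma tensor_eq_equiv : equiv_class_of tensor_eq.
Proof.
split=> [s|s t|t s u]; first exact/asboolP/tensor_refl.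
  by apply/asboolP/asboolP; apply: tensor_sym.
by move=> /asboolP st /asboolP tu; apply/asboolP; apply: tensor_trans tu.
Qed.

Canonical tensor_equiv := EquivRelPack tensor_eq_equiv.

Definition base_change := {eq_quot tensor_eq}.
HB.instance Definition _ := EqQuotient.on base_change.
HB.instance Definition _ := Choice.on base_change.

Definition tsum (s : seq (M * R')) : base_change := \pi_base_change s.

Lemma tsumP s t : tsum s = tsum t <-> tensor_rel s t.
Proof. by split=> [/eqmodP/asboolP|h] //; apply/eqmodP/asboolP. Qed.

Lemma tsum_repr x : tsum (repr x) = x. Proof. exact: reprK. Qed.

Lemma tsumW (P : base_change -> Prop) : (forall s, P (tsum s)) -> forall x, P x.
Proof. by move=> h; elim/quotW. Qed.

Definition tens (m : M) (c : R') : base_change := tsum [:: (m, c)].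

Definition tens_zero : base_change := tsum [::].
Definition tens_add (x y : base_change) := tsum (repr x ++ repr y).
Definition oppl (s : seq (M * R')) := [seq (- p.1, p.2) | p <- s].
Definition tens_opp (x : base_change) := tsum (oppl (repr x)).
Definition scalel c (s : seq (M * R')) := [seq (p.1, c * p.2) | p <- s].
Definition tens_scale c (x : base_change) := tsum (scalel c (repr x)).

Lemma tensor_oppl s t : tensor_rel s t -> tensor_rel (oppl s) (oppl t).
Proof.
elim=> {s t}.
- by move=> s; exact: tensor_refl.
- by move=> s t _; exact: tensor_sym.
- by move=> s t u _ st _; exact: tensor_trans.
- by move=> s s' t t' _ h _ h'; rewrite /oppl !map_cat; exact: tensor_cat.
- by move=> s t; rewrite /oppl !map_cat; exact: tensor_comm.
- by move=> c; rewrite /= oppr0; exact: tensor_zero.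
- by move=> m n c; rewrite /= opprD; exact: tensor_addl.
- by move=> m c d; exact: tensor_addr.
- by move=> r m c; rewrite /= -scalerN; exact: tensor_scale.
Qed.

Lemma tensor_scalel c s t :
  tensor_rel s t -> tensor_rel (scalel c s) (scalel c t).
Proof.
elim=> {s t}.
- by move=> s; exact: tensor_refl.
- by move=> s t _; exact: tensor_sym.
- by move=> s t u _ st _; exact: tensor_trans.
- by move=> s s' t t' _ h _ h'; rewrite /scalel !map_cat; exact: tensor_cat.
- by move=> s t; rewrite /scalel !map_cat; exact: tensor_comm.
- by move=> d; exact: tensor_zero.
- by move=> m n d; exact: tensor_addl.
- by move=> m d e; rewrite /= mulrDr; exact: tensor_addr.
- by move=> r m d; rewrite /= mulrCA; exact: tensor_scale.
Qed.

Lemma tens_addE s t : tens_add (tsum s) (tsum t) = tsum (s ++ t).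
Proof. by apply/tsumP/tensor_cat; apply/tsumP; exact: tsum_repr. Qed.
Lemma tens_oppE s : tens_opp (tsum s) = tsum (oppl s).
Proof. by apply/tsumP/tensor_oppl/tsumP; exact: tsum_repr. Qed.
Lemma tens_scaleE c s : tens_scale c (tsum s) = tsum (scalel c s).
Proof. by apply/tsumP/tensor_scalel/tsumP; exact: tsum_repr. Qed.

Lemma tens_addA : associative tens_add.
Proof.
by elim/tsumW=> s; elim/tsumW=> t; elim/tsumW=> u; rewrite !tens_addE catA.
Qed.
Lemma tens_addC : commutative tens_add.
Proof.
by elim/tsumW=> s; elim/tsumW=> t; rewrite !tens_addE; exact/tsumP/tensor_comm.
Qed.
Lemma tens_add0 : left_id tens_zero tens_add.
Proof. by elim/tsumW=> s; rewrite tens_addE. Qed.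
Lemma tens_addN : left_inverse tens_zero tens_opp tens_add.
Proof.
elim/tsumW=> s; rewrite tens_oppE tens_addE; apply/tsumP.
elim: s => [|[m c] s IHs] /=; first exact: tensor_refl.
apply: (@tensor_trans _ ([:: (- m, c)] ++ ([:: (m, c)] ++ s) ++ oppl s)).
  by apply: (tensor_cat (tensor_refl [:: _])); exact: tensor_comm.
apply: (@tensor_trans _ ([:: (- m, c); (m, c)] ++ (oppl s ++ s))).
  rewrite -[X in tensor_rel X]/([:: (- m, c); (m, c)] ++ (s ++ oppl s)).
  by apply: (tensor_cat (tensor_refl _)); exact: tensor_comm.
rewrite -[X in tensor_rel _ X]cats0; apply: tensor_cat => //.
apply: tensor_trans (tensor_zero c); rewrite -[X in tensor_rel _ [:: (X, _)]](addNr m).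
exact/tensor_sym/tensor_addl.
Qed.

HB.instance Definition _ := GRing.isZmodule.Build base_change
  tens_addA tens_addC tens_add0 tens_addN.

Lemma tens_scaleA a b x : tens_scale a (tens_scale b x) = tens_scale (a * b) x.
Proof.
elim/tsumW: x => s; rewrite !tens_scaleE; congr tsum.
by rewrite /scalel -map_comp; apply: eq_map => p /=; rewrite mulrA.
Qed.
Lemma tens_scale1 : left_id 1 tens_scale.
Proof.
elim/tsumW=> s; rewrite tens_scaleE; congr tsum.
by rewrite /scalel -[RHS]map_id; apply: eq_map => -[m c]; rewrite /= mul1r.
Qed.
Lemma tens_scaleDr : right_distributive tens_scale +%R.
Proof.
move=> a; elim/tsumW=> s; elim/tsumW=> t.
rewrite [tsum s + _]tens_addE !tens_scaleE [RHS]tens_addE.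
by rewrite /scalel map_cat.
Qed.
Lemma tens_scaleDl x : {morph tens_scale^~ x : a b / a + b}.
Proof.
move=> a b; elim/tsumW: x => s; rewrite !tens_scaleE [RHS]tens_addE.
apply/tsumP; elim: s => [|[m c] s IHs] /=; first exact: tensor_refl.
rewrite mulrDl.
apply: (@tensor_trans _ ([:: (m, a * c); (m, b * c)] ++ (scalel a s ++ scalel b s))).
  by apply: (@tensor_cat [:: _]) IHs; exact: tensor_addr.
apply: (tensor_cat (tensor_refl [:: _])).
rewrite -[X in tensor_rel _ X]/(scalel a s ++ [:: (m, b * c)] ++ scalel b s).
rewrite catA; apply: (tensor_cat (tensor_comm [:: (m, b * c)] _)).
exact: tensor_refl.
Qed.

HB.instance Definition _ := GRing.Zmodule_isLmodule.Build R' base_change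
  tens_scaleA tens_scale1 tens_scaleDr tens_scaleDl.
End ExtensionOfScalars.

Definition dual (R : comPzRingType) (N : lmodType R) : lmodType R := Hom N R^o.

(* F(M) = (M (x)_R R~)^** *)
Definition reflexive_extension (R : comPzRingType) (M : lmodType R) :
    lmodType (normalization R) :=
  dual (dual (base_change (@to_normalization R) M)).

Section Finiteness.
Variable R : comPzRingType.

Definition ideal (I : set R) : Prop :=
  [/\ I 0, (forall x y, I x -> I y -> I (x + y)) &
      (forall a x, I x -> I (a * x))].

Definition noetherian : Prop :=
  forall I, ideal I -> exists (n : nat) (x : 'I_n -> R),
    I = [set y | exists a : 'I_n -> R, y = \sum_(i < n) a i * x i].

Definition reduced : Prop := forall (x : R) n, x ^+ n = 0 -> x = 0.

Variable M : lmodType R.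

Definition finitely_generated : Prop :=
  exists (n : nat) (x : 'I_n -> M),
    forall m, exists a : 'I_n -> R, m = \sum_(i < n) a i *: x i.

Definition faithful : Prop :=
  forall r : R, (forall m : M, r *: m = 0) -> r = 0.

Definition torsion_free : Prop :=
  forall (r : R) (m : M), nonzerodivisor r -> r *: m = 0 -> m = 0.
End Finiteness.

Record Spec (R : comPzRingType) := PrimeIdeal {
  prime_set :> set R;
  prime_ideal : ideal prime_set;
  prime_proper : ~ prime_set 1;
  prime_mul : forall x y, prime_set (x * y) -> prime_set x \/ prime_set y
}.

Section Support.
Variables (R : comPzRingType) (p : Spec R).

Lemma prime_compl1 : (~` p) 1. Proof. exact: prime_proper. Qed.
Lemma prime_complM s t : (~` p) s -> (~` p) t -> (~` p) (s * t).
Proof. by move=> ps pt /prime_mul[]. Qed.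

Definition prime_compl := MulSet prime_compl1 prime_complM.
End Support.

Definition ring_at (R : comPzRingType) (p : Spec R) : comPzRingType :=
  loc_ring (prime_compl p).
Definition module_at (R : comPzRingType) (p : Spec R) (M : lmodType R) :
    lmodType (ring_at p) := loc (prime_compl p) M.
Definition alg_at (R : comPzRingType) (p : Spec R) (A : algebra R) :
    pzRingType := loc_alg (prime_compl p) A.

Definition support (R : comPzRingType) (M : lmodType R) : set (Spec R) :=
  [set p | exists x : module_at p M, x != 0].

(* The least n satisfying P, in the extended naturals: [None] is infinity. *)
Definition least (P : nat -> Prop) : option nat :=
  match pselect (exists n, `[< P n >]) with
  | left ex => Some (ex_minn ex)
  | right _ => None
  end.

(* Supremum of the lengths k of chains P 0 < ... < P k of prime ideals; the zero
   ring, which has none, gets dimension 0. *)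
Definition krull_dim (R : comPzRingType) : option nat :=
  least (fun n => forall (k : nat) (P : nat -> Spec R),
    (forall i, (i < k)%N -> (P i : set R) `<` P i.+1) -> (k <= n)%N).

Section Depth.
Variables (R : comPzRingType) (N : lmodType R).

(* The submodule (x_1, ..., x_n) N. *)
Definition ideal_mul (x : seq R) : set N :=
  [set v | exists w : 'I_(size x) -> N, v = \sum_(i < size x) x`_i *: w i].

(* Each x_i is a nonzerodivisor on N / (x_1, ..., x_(i-1)) N, and
   N / (x_1, ..., x_n) N is nonzero. *)
Definition regular_sequence (x : seq R) : Prop :=
  (forall i v, (i < size x)%N ->
     ideal_mul (take i x) (x`_i *: v) -> ideal_mul (take i x) v) /\
  exists v, ~ ideal_mul x v.

(* Supremum of the lengths of the N-regular sequences in I. *)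
Definition depth (I : set R) : option nat :=
  least (fun n => forall x : seq R,
    (forall a, a \in x -> I a) -> regular_sequence x -> (size x <= n)%N).
End Depth.

Definition nonunits (R : comPzRingType) : set R :=
  [set x | ~ exists y, y * x = 1].
Arguments nonunits : clear implicits.

(* [nonunits (ring_at p)] is the maximal ideal of the local ring R_p.  The zero
   module over R_p counts as maximal Cohen-Macaulay. *)
Definition maximal_CM (R : comPzRingType) (N : lmodType R) : Prop :=
  finitely_generated N /\
  forall p : Spec R, support N p ->
    depth (module_at p N) (nonunits (ring_at p)) = krull_dim (ring_at p).

(* Left modules.  Left and right global dimension agree when B is noetherian on
   both sides, as for module-finite algebras over a noetherian ring. *)
Section GlobalDimension.
Variable B : pzRingType.

Definition projective (P : lmodType B) : Prop :=
  forall (U V : lmodType B) (g : {linear U -> V}) (h : {linear P -> V}),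
    (forall v, exists u, g u = v) ->
    exists k : {linear P -> U}, forall x, g (k x) = h x.

(* There is a projective resolution 0 -> P n -> ... -> P 0 -> X -> 0. *)
Definition proj_dim_le (X : lmodType B) (n : nat) : Prop :=
  exists (P : nat -> lmodType B) (d : forall i, {linear P i.+1 -> P i})
         (e : {linear P 0%N -> X}),
    [/\ forall i, projective (P i),
        forall i, (n < i)%N -> forall x : P i, x = 0,
        forall x, exists y, e y = x,
        forall y, e y = 0 <-> exists z, d 0%N z = y &
        forall i y, d i y = 0 <-> exists z, d i.+1 z = y].

Definition gl_dim : option nat :=
  least (fun n => forall X : lmodType B, proj_dim_le X n).
End GlobalDimension.

Definition nonsingular_order (R : comPzRingType) (A : algebra R) : Prop :=
  maximal_CM A /\
  forall p : Spec R, gl_dim (alg_at p A) = krull_dim (ring_at p).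

Definition gives_NCCR (R : comPzRingType) (M : lmodType R) : Prop :=
  [/\ finitely_generated M, torsion_free M, support M = support R^o &
      nonsingular_order (End_alg M)].

(* Main.v *)
(** Write A = End_R(M), S for the normalization and Q for the total quotient
    ring of R.  Since A is maximal Cohen-Macaulay, an element f of A is divisible
    by a nonzerodivisor d as soon as it is so locally at the primes p with
    dim R_p <= 1, and there A_p is left hereditary, as gldim A_p = dim R_p.  At
    such a prime:
    - for x = a/b in S, projectivity of the left ideal (a, b) of A_p makes it
      invertible, and x being integral this gives x in A_p.  So S acts on M;
    - M_p is projective over A_p, so it is a generator over S_p and S_p is a
      direct summand of A_p.  The A_p-span of M_p in a free A_p-module is
      projective too, and compressing a dual basis of it to S_p shows that M_p is
      projective, hence reflexive, over S_p.
    An endomorphism of F(M) therefore maps M to M locally at all these primes,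
    hence globally; as M and F(M) agree over Q, it is the image of a unique
    element of A. *)
From HB Require Import structures.
Require Import Defs.
From mathcomp Require Import all_boot all_algebra.
From mathcomp Require Import boolp classical_sets.
From mathcomp Require Import ring.

Set Implicit Arguments.
Unset Strict Implicit.
Unset Printing Implicit Defensive.

Import Defs GRing.Theory.

Local Open Scope ring_scope.
Local Open Scope quotient_scope.
Local Open Scope classical_set_scope.

(** * Noetherian reduced rings *)

Section Ideals.
Variable R : comPzRingType.
Hypothesis R_noetherian : noetherian R.

Lemma ideal_sum (I : set R) n (F : 'I_n -> R) :
  ideal I -> (forall i, I (F i)) -> I (\sum_(i < n) F i).
Proof. by case=> I0 ID _ IF; elim/big_ind: _. Qed.

(** Otherwise there is a chain [F (s n)] that grows strictly at every step; its union is an ideal,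
    and one member of the chain already contains its finitely many generators. The index type [J]
    lets a maximal ideal come together with the element that defines it. *)
Lemma noetherian_maximal (J : Type) (F : J -> set R) (P : J -> Prop) :
  (forall i, P i -> ideal (F i)) -> (exists i, P i) ->
  exists2 i, P i & forall j, P j -> F i `<=` F j -> F j `<=` F i.
Proof.
move=> F_ideal [i0 Pi0]; apply: contrapT => no_max.
have next (i : {i | P i}) :
    exists j : {i | P i}, F (sval i) `<=` F (sval j) /\ ~ F (sval j) `<=` F (sval i).
  apply: contrapT => no_next; apply: no_max; exists (sval i); first exact: svalP.
  move=> j Pj le_ij; apply: contrapT => nle_ji.
  by apply: no_next; exists (exist _ j Pj).
have [nx nxP] := choice next.
pose s n := sval (iter n nx (exist _ i0 Pi0)).
have sI n : ideal (F (s n)) by apply: F_ideal; exact: svalP.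
have le_s m n : (m <= n)%N -> F (s m) `<=` F (s n).
  elim: n => [|n IH]; first by rewrite leqn0 => /eqP ->.
  rewrite leq_eqVlt => /predU1P[-> //|/IH sub]; apply: (subset_trans sub).
  exact: (nxP _).1.
pose U : set R := [set x | exists n, F (s n) x].
have UI : ideal U.
  split; first by exists 0%N; case: (sI 0%N).
    move=> x y [m Fx] [n Fy]; exists (maxn m n).
    case: (sI (maxn m n)) => _ FD _.
    by apply: FD; [apply: le_s Fx; exact: leq_maxl | apply: le_s Fy; exact: leq_maxr].
  by move=> a x [n Fx]; exists n; case: (sI n) => _ _; exact.
have [k [x Ux]] := R_noetherian UI.
have xU i : exists n, F (s n) (x i).
  have : U (x i); last by [].
  rewrite Ux; exists (fun j => (j == i)%:R).
  by rewrite (bigD1 i)//= eqxx mul1r big1 ?addr0// => j /negPf ->; rewrite mul0r.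
have [m mP] := choice xU.
pose N := (\max_(i < k) m i)%N.
apply: (nxP (iter N nx (exist _ i0 Pi0))).2 => y Fy.
have : U y by exists N.+1.
rewrite Ux => -[a ->]; apply: ideal_sum (sI N) _ => i.
case: (sI N) => _ _; apply; apply: (le_s (m i)) => //; exact: leq_bigmax.
Qed.

(** A maximal one among the annihilators of the nonzero multiples of [f] in L / N is prime: if x y
    kills r f and x does not, then x r f is again nonzero, and its annihilator contains both y and
    the annihilator of r f. *)
Lemma associated_prime (L : lmodType R) (N : set L) (f : L) :
  N 0 -> (forall x y, N x -> N y -> N (x + y)) ->
  (forall a x, N x -> N (a *: x)) -> ~ N f ->
  exists (r : R) (p : Spec R), forall t, (p : set R) t <-> N (t *: (r *: f)).
Proof.
move=> N0 ND NZ Nf.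
pose F r : set R := [set t | N (t *: (r *: f))].
have FI r : ideal (F r).
  split; first by rewrite /F /= scale0r.
    by move=> x y; rewrite /F /= scalerDl; exact: ND.
  by move=> a x; rewrite /F /= -scalerA; exact: NZ.
have [|r Nr r_max] := @noetherian_maximal R F (fun r => ~ N (r *: f)) (fun r _ => FI r).
  by exists 1; rewrite scale1r.
have F_proper : ~ F r 1 by rewrite /F /= scale1r.
have F_mul x y : F r (x * y) -> F r x \/ F r y.
  move=> Fxy; case: (pselect (F r x)) => [|Fx]; [by left | right].
  apply: (r_max (x * r)); rewrite /F /=; first by rewrite -scalerA.
    move=> t Ft /=; have -> : t *: (x * r *: f) = x *: (t *: (r *: f)).
      by rewrite !scalerA; congr (_ *: _); ring.
    exact: NZ.
  by move: Fxy; rewrite /F /= !scalerA; congr (N (_ *: f)); ring.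
by exists r, (PrimeIdeal (FI r) F_proper F_mul).
Qed.

Hypothesis R_reduced : reduced R.

Lemma reduced_sqr (x : R) : x * x = 0 -> x = 0.
Proof. by rewrite -expr2; exact: R_reduced. Qed.

(** An x in I with maximal double annihilator [F x] works. If y x = 0 and z is in I, the double
    annihilator of x + y z contains both [F x] and y z, so y z lies in [F x]. Since y z kills x, its
    square is zero; hence y kills I. *)
Lemma nonzerodivisor_in_ideal (I : set R) : ideal I ->
  (forall c, (forall x, I x -> c * x = 0) -> c = 0) ->
  exists2 x, I x & nonzerodivisor x.
Proof.
move=> II annI; have [I0 ID IM] := II.
pose F x : set R := [set t | forall y, y * x = 0 -> t * y = 0].
have FI x : ideal (F x).
  split=> [y _|t u Ft Fu y yx|a t Ft y yx]; first by rewrite mul0r.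
    by rewrite mulrDl Ft ?Fu ?addr0.
  by rewrite -mulrA Ft ?mulr0.
have [|x Ix x_max] := @noetherian_maximal R F I (fun x _ => FI x).
  by exists 0.
exists x => // y; rewrite mulrC => yx; apply: annI => z Iz.
(* As [y x = 0] and [R] is reduced, the annihilator of [x + y z] is the
   intersection of those of [x] and [y z]. *)
apply: reduced_sqr.
have xyz t : t * (x + y * z) = 0 -> t * x = 0 /\ t * (y * z) = 0.
  rewrite mulrDr => e; have tx : t * x = 0.
    apply: reduced_sqr; have : (t * x + t * (y * z)) * (t * x) = 0.
      by rewrite e mul0r.
    have -> : (t * x + t * (y * z)) * (t * x) = t * x * (t * x) + t * t * z * (y * x).
      by ring.
    by rewrite yx mulr0 addr0.
  by move: e; rewrite tx add0r.
have Fyz : F x (y * z).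
  apply: (x_max (x + y * z)).
  - by apply: ID => //; exact: IM.
  - by move=> t Ft u /xyz[ux _]; exact: Ft.
  - by move=> u /xyz[_]; rewrite mulrC.
by apply: Fyz; rewrite mulrAC yx mul0r.
Qed.
End Ideals.

Lemma linear_function_exists (B : pzRingType) (U V : lmodType B) (f : U -> V) :
  linear f -> exists g : {linear U -> V}, g =1 f.
Proof.
move=> lin_f.
pose g : {linear U -> V} := HB.pack f (GRing.isLinear.Build B U V *:%R f lin_f).
by exists g.
Qed.

Lemma hom_sumE (R : comPzRingType) (U V : lmodType R) (I : Type) (r : seq I)
    (F : I -> Hom U V) (u : U) :
  (\sum_(i <- r) F i : Hom U V) u = \sum_(i <- r) F i u.
Proof. by elim/big_rec2: _ => // i y f _ <-. Qed.

Lemma prime_prod (R : comPzRingType) (p : Spec R) (I : finType) (s : I -> R) :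
  (forall i, ~ (p : set R) (s i)) -> ~ (p : set R) (\prod_i s i).
Proof.
move=> ps; elim/big_ind: _ => //; first exact: prime_proper.
by move=> x y px py /prime_mul[].
Qed.

(** * Dual bases over the total quotient ring *)

Section DualBasis.
Variable R : comPzRingType.
Hypotheses (R_noetherian : noetherian R) (R_reduced : reduced R).
Variables (M : lmodType R) (l : nat) (x : 'I_l -> M).
Hypothesis x_gen : forall m, exists a : 'I_l -> R, m = \sum_(j < l) a j *: x j.

(** An element of this ideal outside a prime p yields a dual basis of M_p. *)
Let dual_basis_ideal : set R :=
  [set d | exists lam : 'I_l -> Hom M R^o,
     forall m, d *: m = \sum_(j < l) (lam j m : R) *: x j].

Lemma dual_basis_idealP : ideal dual_basis_ideal.
Proof.
split.
- exists (fun=> 0) => m; rewrite scale0r big1// => j _; exact: scale0r.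
- move=> d e [lam lamP] [mu muP]; exists (fun j => lam j + mu j) => m.
  rewrite scalerDl lamP muP -big_split/=; apply: eq_bigr => j _.
  by rewrite -scalerDl.
- move=> a d [lam lamP]; exists (fun j => a *: lam j) => m.
  rewrite -scalerA lamP scaler_sumr; apply: eq_bigr => j _.
  by rewrite scalerA.
Qed.

(* The local ring at [p] is a field, as [c] is a unit there that kills [p]; a
   spanning family of [M_p] of least size is a basis of this vector space. *)
Lemma dual_basis_at (p : Spec R) (c : R) :
  (forall t, (p : set R) t <-> t * c = 0) -> ~ (p : set R) c ->
  exists2 d, dual_basis_ideal d & ~ (p : set R) d.
Proof.
move=> pE pc.
pose spans k := exists (z : 'I_k -> M) (D : R), ~ (p : set R) D /\
  forall m, exists t : 'I_k -> R, D *: m = \sum_(i < k) t i *: z i.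
have ex_spans : exists k, `[< spans k >].
  exists l; apply/asboolP; exists x, 1; split; first exact: prime_proper.
  by move=> m; have [a ->] := x_gen m; exists a; rewrite scale1r.
have [k /asboolP [z [D [pD /choice [tau tauP]]]] k_min] := ex_minnP ex_spans.
(* Otherwise [a i] is invertible at p and [z i] becomes a combination of the other vectors, against
   the minimality of [k]. *)
have z_free (a : 'I_k -> R) : \sum_(i < k) a i *: z i = 0 -> forall i, (p : set R) (a i).
  move=> az i; apply: contrapT => pai.
  have : spans k.-1; last first.
    move=> /asboolP /k_min; rewrite leqNgt ltn_predL.
    by rewrite (leq_ltn_trans _ (ltn_ord i)).
  exists (fun j => z (lift i j)), (a i * D); split; first by case/prime_mul.
  move=> m; exists (fun j => a i * tau m (lift i j) - tau m i * a (lift i j)).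
  rewrite -scalerA tauP (bigD1_ord i)//= scalerDr scalerA.
  move: az; rewrite (bigD1_ord i)//= => /eqP; rewrite addr_eq0 => /eqP az.
  rewrite mulrC -scalerA az scalerN !scaler_sumr -sumrN -big_split/=.
  by apply: eq_bigr => j _; rewrite scalerBl !scalerA addrC.
(* The coordinates of [D *: m] are determined only modulo p; multiplying them by [c], which kills p,
   makes them unique and hence linear in [m]. *)
have tau_uniq m t : D *: m = \sum_(i < k) t i *: z i ->
    forall i, tau m i * c = t i * c.
  move=> e i; apply/eqP; rewrite -subr_eq0 -mulrBl; apply/eqP/pE.
  apply: (z_free (fun i => tau m i - t i)).
  under eq_bigr do rewrite scalerBl.
  by rewrite sumrB -tauP e subrr.
have lin i : linear (fun m => tau m i * c : R^o).
  move=> a u v; rewrite (tau_uniq _ (fun i => a * tau u i + tau v i)).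
    by rewrite mulrDl -mulrA.
  rewrite scalerDr scalerA mulrC -scalerA !tauP scaler_sumr -big_split/=.
  by apply: eq_bigr => j _; rewrite scalerDl scalerA.
have [lam lamP] : {lam : 'I_k -> Hom M R^o &
    forall i, lam i =1 fun m => tau m i * c}.
  exact: (choice (fun i => linear_function_exists (lin i))).
have [mu muP] := choice (fun i => x_gen (z i)).
exists (c * D); last by case/prime_mul.
exists (fun j => \sum_i mu i j *: lam i) => m.
rewrite -scalerA tauP scaler_sumr.
transitivity (\sum_i \sum_j (mu i j * (tau m i * c)) *: x j).
  apply: eq_bigr => i _; rewrite muP !scaler_sumr; apply: eq_bigr => j _.
  by rewrite !scalerA; congr (_ *: _); ring.
rewrite exchange_big; apply: eq_bigr => j _; rewrite -scaler_suml.
by rewrite hom_sumE; congr (_ *: _); apply: eq_bigr => i _; rewrite /= lamP.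
Qed.

(* The total quotient ring of [R] is a product of fields, so [M] becomes
   projective over it; [d] clears the denominators of a dual basis. *)
Lemma generic_dual_basis : exists (d : R) (lam : 'I_l -> Hom M R^o),
  nonzerodivisor d /\ forall m, d *: m = \sum_(j < l) (lam j m : R) *: x j.
Proof.
suff [d [lam lamP] dreg] : exists2 d, dual_basis_ideal d & nonzerodivisor d.
  by exists d, lam.
apply: nonzerodivisor_in_ideal => //; first exact: dual_basis_idealP.
move=> c cd; apply: contrapT => c0.
have [||r [p pE]] := @associated_prime R R_noetherian R^o [set 0] c erefl _ _ c0.
- by move=> _ _ -> ->; rewrite /= addr0.
- by move=> a _ ->; rewrite /= scaler0.
(* Here p is the annihilator of r c. Were r c in p, its square would vanish, and so would r c
   because R is reduced. *)
have prc : ~ (p : set R) (r * c).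
  move=> /pE /(reduced_sqr R_reduced) rc.
  by apply: (@prime_proper _ p); apply/pE; rewrite /= scale1r.
have [t|d dI] := @dual_basis_at p (r * c) _ prc; first exact: pE.
by apply; apply/pE; rewrite /= -[_ *: _]/(d * (r * c)) mulrCA [d * c]mulrC cd ?mulr0.
Qed.
End DualBasis.

(** * Rings of global dimension at most 1 *)

Record submodule (B : pzRingType) (U : lmodType B) := Submodule {
  submodule_set :> set U;
  submodule0 : submodule_set 0;
  submoduleD : forall x y, submodule_set x -> submodule_set y ->
    submodule_set (x + y);
  submoduleZ : forall b x, submodule_set x -> submodule_set (b *: x)
}.

Lemma submoduleN (B : pzRingType) (U : lmodType B) (N : submodule U) x :
  (N : set U) x -> (N : set U) (- x).
Proof. by rewrite -scaleN1r; exact: submoduleZ. Qed.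

Section Quotient.
Variables (B : pzRingType) (U : lmodType B) (N : submodule U).

Definition quot_rel (x y : U) : bool := `[< (N : set U) (x - y) >].

Lemma quot_rel_equiv : equiv_class_of quot_rel.
Proof.
split=> [x|x y|y x z]; first by apply/asboolP; rewrite subrr; exact: submodule0.
  apply/asboolP/asboolP => Nxy;
    by rewrite -opprB; exact: submoduleN.
move=> /asboolP xy /asboolP yz; apply/asboolP.
by rewrite -(subrKA y); exact: submoduleD.
Qed.

Canonical quot_equiv := EquivRelPack quot_rel_equiv.

Definition quot := {eq_quot quot_rel}.
HB.instance Definition _ := EqQuotient.on quot.
HB.instance Definition _ := Choice.on quot.

Definition to_quot (x : U) : quot := \pi_quot x.

Lemma to_quotP x y : to_quot x = to_quot y <-> (N : set U) (x - y).
Proof. by split=> [/eqmodP/asboolP|h] //; apply/eqmodP/asboolP. Qed.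

Lemma to_quot_repr (x : quot) : to_quot (repr x) = x.
Proof. exact: reprK. Qed.

Lemma quotW (P : quot -> Prop) : (forall x, P (to_quot x)) -> forall q, P q.
Proof. by move=> h q; rewrite -(to_quot_repr q). Qed.

Definition quot_opp (q : quot) := to_quot (- repr q).
Definition quot_add (q r : quot) := to_quot (repr q + repr r).
Definition quot_scale (b : B) (q : quot) := to_quot (b *: repr q).

Lemma repr_to_quot x : (N : set U) (repr (to_quot x) - x).
Proof. exact/to_quotP/to_quot_repr. Qed.

Lemma quot_oppE x : quot_opp (to_quot x) = to_quot (- x).
Proof.
apply/to_quotP; by rewrite -opprD; exact/submoduleN/repr_to_quot.
Qed.
Lemma quot_addE x y : quot_add (to_quot x) (to_quot y) = to_quot (x + y).
Proof.
by apply/to_quotP; rewrite opprD addrACA; apply: submoduleD; exact: repr_to_quot.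
Qed.
Lemma quot_scaleE b x : quot_scale b (to_quot x) = to_quot (b *: x).
Proof. by apply/to_quotP; rewrite -scalerBr; apply: submoduleZ; exact: repr_to_quot. Qed.

Lemma quot_addA : associative quot_add.
Proof.
by elim/quotW=> x; elim/quotW=> y; elim/quotW=> z; rewrite !quot_addE addrA.
Qed.
Lemma quot_addC : commutative quot_add.
Proof. by elim/quotW=> x; elim/quotW=> y; rewrite !quot_addE addrC. Qed.
Lemma quot_add0 : left_id (to_quot 0) quot_add.
Proof. by elim/quotW=> x; rewrite quot_addE add0r. Qed.
Lemma quot_addN : left_inverse (to_quot 0) quot_opp quot_add.
Proof. by elim/quotW=> x; rewrite quot_oppE quot_addE addNr. Qed.

HB.instance Definition _ := GRing.isZmodule.Build quot
  quot_addA quot_addC quot_add0 quot_addN.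

Lemma quot_scaleA a b q : quot_scale a (quot_scale b q) = quot_scale (a * b) q.
Proof. by elim/quotW: q => x; rewrite !quot_scaleE scalerA. Qed.
Lemma quot_scale1 : left_id 1 quot_scale.
Proof. by elim/quotW=> x; rewrite quot_scaleE scale1r. Qed.
Lemma quot_scaleDr : right_distributive quot_scale +%R.
Proof.
move=> a; elim/quotW=> x; elim/quotW=> y.
by rewrite [to_quot x + _]quot_addE !quot_scaleE scalerDr -quot_addE.
Qed.
Lemma quot_scaleDl q : {morph quot_scale^~ q : a b / a + b}.
Proof.
by elim/quotW: q => x a b; rewrite !quot_scaleE scalerDl -quot_addE.
Qed.

HB.instance Definition _ := GRing.Zmodule_isLmodule.Build B quot
  quot_scaleA quot_scale1 quot_scaleDr quot_scaleDl.

Lemma to_quot_linear : linear to_quot.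
Proof.
by move=> b x y; rewrite -[RHS]/(quot_add (quot_scale b _) _) quot_scaleE quot_addE.
Qed.
HB.instance Definition _ := GRing.isLinear.Build B U quot *:%R to_quot to_quot_linear.

Lemma to_quot_surj q : exists x, to_quot x = q.
Proof. by exists (repr q); exact: to_quot_repr. Qed.

Lemma to_quot_eq0 x : to_quot x = 0 <-> (N : set U) x.
Proof. by rewrite -[in X in _ <-> X](subr0 x); exact: to_quotP. Qed.
End Quotient.

Section Kernel.
Variables (B : pzRingType) (U V : lmodType B) (f : {linear U -> V}).

Lemma ker_submodule_subproof : [/\ f 0 = 0,
  forall x y, f x = 0 -> f y = 0 -> f (x + y) = 0 &
  forall b x, f x = 0 -> f (b *: x) = 0].
Proof.
split=> [|x y fx fy|b x fx]; first exact: linear0.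
  by rewrite linearD fx fy addr0.
by rewrite linearZ_LR /= fx scaler0.
Qed.
Definition ker_submodule : submodule U :=
  let: And3 h0 hD hZ := ker_submodule_subproof in
  @Submodule _ _ [set x | f x = 0] h0 hD hZ.

Lemma img_submodule_subproof : [/\ exists x, f x = 0,
  forall v w, (exists x, f x = v) -> (exists x, f x = w) -> exists x, f x = v + w &
  forall b v, (exists x, f x = v) -> exists x, f x = b *: v].
Proof.
split=> [|_ _ [x <-] [y <-]|b _ [x <-]]; first by exists 0; exact: linear0.
  by exists (x + y); rewrite linearD.
by exists (b *: x); rewrite linearZ_LR.
Qed.
Definition img_submodule : submodule V :=
  let: And3 h0 hD hZ := img_submodule_subproof in
  @Submodule _ _ [set v | exists x, f x = v] h0 hD hZ.

Lemma ker_submoduleE x : (ker_submodule : set U) x <-> f x = 0.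
Proof. by rewrite /ker_submodule; case: ker_submodule_subproof. Qed.
Lemma img_submoduleE v : (img_submodule : set V) v <-> exists x, f x = v.
Proof. by rewrite /img_submodule; case: img_submodule_subproof. Qed.
End Kernel.

Lemma free_module_lift (B : pzRingType) (n : nat) (U V : lmodType B)
    (g : {linear U -> V}) (f : {linear 'rV[B]_n -> V}) :
  (forall v, exists u, g u = f v) ->
  exists h : {linear 'rV[B]_n -> U}, forall v, g (h v) = f v.
Proof.
move=> /choice[u uP].
pose h (v : 'rV[B]_n) : U := \sum_i v 0 i *: u (delta_mx 0 i).
have lin_h : linear h.
  move=> b v w; rewrite /h scaler_sumr -big_split/=; apply: eq_bigr => i _.
  by rewrite !mxE scalerDl scalerA.
have [k kE] := linear_function_exists lin_h.
exists k => v; rewrite kE linear_sum [in RHS](row_sum_delta v) linear_sum.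
by apply: eq_bigr => i _; rewrite !linearZ_LR/= uP.
Qed.

(* Every submodule of a finitely generated free module is projective when [B]
   has global dimension at most 1; [E] is the matrix of a splitting of the map
   from [B^l] onto the row space of [Y], read on the rows of [Y]. *)
Lemma row_space_splitting (B : pzRingType) (l k : nat) (Y : 'M[B]_(l, k)) :
  (forall X : lmodType B, proj_dim_le X 1) ->
  exists E : 'M[B]_l, E *m Y = Y /\
    forall b : 'rV[B]_l, b *m Y = 0 -> b *m E = 0.
Proof.
move=> gld.
have [pi piE] : exists pi : {linear 'rV[B]_l -> 'rV[B]_k}, forall v, pi v = v *m Y.
  apply: linear_function_exists => b v w.
  by rewrite mulmxDl scalemxAl.
pose X : lmodType B := quot (img_submodule pi).
pose eps : {linear 'rV[B]_k -> X} := @to_quot _ _ (img_submodule pi).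
have epsE v : eps v = 0 <-> exists w, pi w = v.
  by rewrite -img_submoduleE; exact: to_quot_eq0.
have [P [d [e [P_proj P_zero e_surj e_ex d_ex]]]] := gld X.
have d_inj z : d 0%N z = 0 -> z = 0.
  by move=> /d_ex[y]; rewrite (P_zero 2%N isT y) linear0.
(* [g] and [h] lift the identity of [X] between its presentation by [Y] and its projective
   resolution, as in Schanuel's lemma. *)
have [g gE] := free_module_lift (fun v => e_surj (eps v)).
have [h hE] := P_proj 0%N _ _ eps e (@to_quot_surj _ _ (img_submodule pi)).
pose K := ker_submodule pi.
have hd z : exists v, pi v = h (d 0%N z).
  by apply/epsE; rewrite hE; apply/e_ex; exists z.
have [s0 s0E] := choice hd.
have toK v w : to_quot K v = to_quot K w <-> pi v = pi w.
  rewrite to_quotP ker_submoduleE linearB; split=> [/eqP|->]; last exact: subrr.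
  by rewrite subr_eq0 => /eqP.
have [q qE] : exists q : {linear P 1%N -> quot K}, forall z, q z = to_quot K (s0 z).
  apply: linear_function_exists => b z w; rewrite -linearP.
  by apply/toK; rewrite linearP !s0E !linearP.
have [s sE] := P_proj 1%N _ _ (to_quot K : {linear _ -> _}) q (@to_quot_surj _ _ K).
have pi_s z : pi (s z) = h (d 0%N z) by rewrite -s0E; apply/toK; rewrite sE qE.
have [r rE] : exists r : {linear 'rV[B]_k -> 'rV[B]_l},
    forall v, pi (r v) = h (g v) - v.
  have [f fE] : exists f : {linear 'rV[B]_k -> 'rV[B]_k},
      forall v, f v = h (g v) - v.
    apply: linear_function_exists => b v w.
    by rewrite [g _]linearP [h _]linearP scalerBr opprD addrACA.
  have [v|r rE] := @free_module_lift _ _ _ _ pi f.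
    by apply/epsE; rewrite fE linearB hE gE subrr.
  by exists r => v; rewrite rE fE.
have ex_z j : exists z, d 0%N z = g (row j Y).
  apply/e_ex; rewrite gE; apply/epsE; exists (delta_mx 0 j).
  by rewrite piE rowE.
have [z zE] := choice ex_z.
(* For v in the row space, g v has a unique preimage z under [d 0], and pi (s z - r v) = h (g v) -
   (h (g v) - v) = v. *)
exists (\matrix_j (s (z j) - r (row j Y))); split=> [|b bY].
  apply/row_matrixP => j; rewrite row_mul rowK -piE linearB pi_s rE zE.
  by rewrite opprB addrC subrK.
have sum_z : \sum_j b 0 j *: z j = 0.
  apply: d_inj; rewrite -(linear0 g) -bY mulmx_sum_row !linear_sum.
  by apply: eq_bigr => j _; rewrite !linearZ_LR/= zE.
transitivity (s (\sum_j b 0 j *: z j) - r (b *m Y)).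
  rewrite !mulmx_sum_row [s _]linear_sum [r _]linear_sum -sumrB; apply: eq_bigr => j _.
  by rewrite rowK scalerBr [s (_ *: _)]linearZ_LR [r (_ *: _)]linearZ_LR.
by rewrite sum_z bY [s 0]linear0 [r 0]linear0 subrr.
Qed.

(** * Primes of height at most 1 *)

Lemma leastP (P : nat -> Prop) n : least P = Some n -> P n.
Proof.
by rewrite /least; case: pselect => // ex [<-]; case: ex_minnP => m /asboolP.
Qed.

Lemma least_le (P : nat -> Prop) m : P m -> exists2 n, least P = Some n & (n <= m)%N.
Proof.
rewrite /least => Pm; case: pselect => [ex|]; last by case; exists m; apply/asboolP.
by case: ex_minnP => n _ n_min; exists n => //; apply/n_min/asboolP.
Qed.

Lemma proj_dim_le_trans (B : pzRingType) (X : lmodType B) n m :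
  (n <= m)%N -> proj_dim_le X n -> proj_dim_le X m.
Proof.
move=> nm [P [d [e [P_proj P0 e_surj e_ex d_ex]]]]; exists P, d, e; split=> // i mi.
by apply: P0; exact: leq_ltn_trans mi.
Qed.

(* [b] spans a copy of the residue field in [L / d L], so [L] has depth one. *)
Lemma regular_sequence_le1 (R : comPzRingType) (L : lmodType R) (I : set R)
    (d : R) (b : L) (x : seq R) :
  (forall v : L, d *: v = 0 -> v = 0) ->
  (forall y, I y -> exists e, y *: b = d *: e) -> ~ (exists e, b = d *: e) ->
  (forall a, a \in x -> I a) -> regular_sequence L x -> (size x <= 1)%N.
Proof.
move=> d_reg bI b_nd; case: x => [//|x1 [//|x2 xs]] xI [x_reg _]; exfalso.
have x1_reg (v : L) : x1 *: v = 0 -> v = 0.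
  move=> e; have [|w ->] := x_reg 0%N v isT; last by rewrite big_ord0.
  by exists (fun=> 0); rewrite /= e big_ord0.
(* From x1 b = d c and x2 b = d e, cancelling d gives x2 c = x1 e. Regularity of x2 modulo x1 then
   gives c = x1 w, and cancelling x1 leaves b = d w. *)
have [c cE] := bI x1 (xI _ (mem_head _ _)).
have [e eE] := bI x2 (xI _ (@mem_behead _ [:: x1, x2 & xs] _ (mem_head _ _))).
have x2c : x2 *: c = x1 *: e.
  apply/eqP; rewrite -subr_eq0; apply/eqP/d_reg.
  by rewrite scalerBr !scalerA ![d * _]mulrC -!scalerA -cE -eE !scalerA mulrC subrr.
have [|w cw] := x_reg 1%N c isT.
  by exists (fun=> e); rewrite /= big_ord1.
apply: b_nd; exists (w ord0); apply/eqP; rewrite -subr_eq0; apply/eqP/x1_reg.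
move: cw; rewrite /= big_ord1 /= => cw.
by rewrite scalerBr cE cw !scalerA mulrC subrr.
Qed.

Section LocalGlobal.
Variables (R : comPzRingType) (p : Spec R).

Lemma denomP (s : prime_compl p) : ~ (p : set R) (sval s).
Proof. by case: s => s /= ; rewrite inE. Qed.

Lemma denom_exists s : ~ (p : set R) s -> exists u : prime_compl p, sval u = s.
Proof. by move=> ps; exists (exist _ s (mem_set ps)). Qed.

Lemma nonunit_at (q : R) (s : prime_compl p) :
  nonunits (ring_at p) (rfrac q s) -> (p : set R) q.
Proof.
move=> nu; apply: contrapT => /denom_exists[u uq]; apply: nu.
exists (rfrac (sval s) u); rewrite rfracM; apply/rfracP; exists (denom1 _).
by rewrite /= uq !mul1r mulr1 mulrC.
Qed.

Lemma at_scaleE (L : lmodType R) (c : R) (m : L) (s : prime_compl p) :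
  (rfrac c (denom1 _) : ring_at p) *: (frac m s : module_at p L) = frac (c *: m) s.
Proof.
by rewrite -[LHS]/(loc_scale _ _) loc_scaleE; apply: frac_eq; rewrite /= mul1r.
Qed.

Lemma frac_eq0 (L : lmodType R) (m : L) (s : prime_compl p) :
  (frac m s : module_at p L) = 0 <-> exists2 u, ~ (p : set R) u & u *: m = 0.
Proof.
rewrite -[0]/(frac 0 (denom1 _)) fracP; split=> [[u /=]|[u pu um]].
  by rewrite scale1r !scaler0 => um; exists (sval u) => //; exact: denomP.
by have [v vu] := denom_exists pu; exists v; rewrite /= scale1r vu !scaler0.
Qed.

Lemma common_denominator (I : finType) (P : I -> R -> Prop) :
  (forall i, exists2 s, ~ (p : set R) s & P i s) ->
  (forall i u s, P i s -> P i (u * s)) ->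
  exists2 s, ~ (p : set R) s & forall i, P i s.
Proof.
move=> exP PM.
have [s sP] := choice (fun i => let: ex_intro2 s ps Ps := exP i in
  ex_intro (fun s => ~ (p : set R) s /\ P i s) s (conj ps Ps)).
exists (\prod_i s i); first by apply: prime_prod => i; case: (sP i).
by move=> i; rewrite (bigD1 i)//= mulrC; apply: PM; case: (sP i).
Qed.
End LocalGlobal.

(* The condition on modules over [alg_at p A] stands for [p] having height at most
   1; what it has to cover is the associated primes of [A / d A]. *)
Lemma divisible_locally (R : comPzRingType) (A : algebra R) (d : R) (f : A) :
  noetherian R -> nonsingular_order A ->
  (forall v : A, d *: v = 0 -> v = 0) ->
  (forall p : Spec R, (forall X : lmodType (alg_at p A), proj_dim_le X 1) ->
    exists2 t, ~ (p : set R) t & exists g : A, t *: f = d *: g) ->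
  exists g : A, f = d *: g.
Proof.
move=> R_noeth [[_ A_CM] A_gldim] d_reg loc; apply: contrapT => fd.
have [||| r [p pE]] := @associated_prime R R_noeth A
    [set v | exists g, v = d *: g] f _ _ _ fd.
- by exists 0; rewrite scaler0.
- by move=> _ _ [v ->] [w ->]; exists (v + w); rewrite scalerDr.
- by move=> a _ [v ->]; exists (a *: v); rewrite !scalerA mulrC.
pose b : module_at p A := frac (r *: f) (denom1 _).
pose d' : ring_at p := rfrac d (denom1 _).
have b_neq0 : b != 0.
  apply/eqP => /frac_eq0[u pu urf]; apply/pu/pE.
  by exists 0; rewrite urf scaler0.
have depth_le1 x : (forall a, a \in x -> nonunits (ring_at p) a) ->
    regular_sequence (module_at p A) x -> (size x <= 1)%N.
  apply: (@regular_sequence_le1 _ _ _ d' b).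
  - elim/locW=> v s; rewrite at_scaleE => /frac_eq0[u pu udv].
    apply/frac_eq0; exists u => //; apply: d_reg.
    by rewrite scalerA mulrC -scalerA.
  - elim/loc_ringW=> q s /nonunit_at /pE[g gE].
    exists (frac g s); rewrite at_scaleE -[LHS]/(loc_scale _ _) loc_scaleE gE.
    by apply: frac_eq; rewrite /= mulr1.
  - case; elim/locW=> v s; rewrite at_scaleE => /fracP[u /=].
    rewrite scale1r scalerA => e; apply: (@prime_complM _ p (sval u) (sval s)).
    + exact: denomP.
    + exact: denomP.
    by apply/pE; exists (sval u *: v); rewrite e !scalerA mulrC.
(* The depth of A_p is at most 1 and A is Cohen-Macaulay, so dim R_p, and with it gldim A_p, is at
   most 1 and the local hypothesis applies. *)
have [n dn n1] : exists2 n,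
    depth (module_at p A) (nonunits (ring_at p)) = Some n & (n <= 1)%N.
  by apply: least_le => x; exact: depth_le1.
have /A_CM : support A p by exists b.
rewrite dn => kd.
have /leastP gl := etrans (A_gldim p) (esym kd).
have [|t pt [g tf]] := loc p; first by move=> X; exact: proj_dim_le_trans (gl X).
by apply/pt/pE; exists (r *: g); rewrite scalerA mulrC -scalerA tf !scalerA mulrC.
Qed.

Lemma central_scalemxAr (B : pzRingType) (z : B) m n q
    (X : 'M[B]_(m, n)) (Z : 'M[B]_(n, q)) :
  (forall b, z * b = b * z) -> z *: (X *m Z) = X *m (z *: Z).
Proof.
move=> zC; apply/matrixP => i j; rewrite !mxE mulr_sumr; apply: eq_bigr => a _.
by rewrite mxE !mulrA zC.
Qed.

(** * Descending a splitting from the localization *)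

Section LocalSplitting.
Variables (R : comPzRingType) (M : lmodType R).

Definition homothety (r : R) : End M := r *: End_one M.

Lemma homothetyE r f : homothety r * f = r *: f.
Proof. exact: HomP. Qed.

Lemma homothetyC r f : homothety r * f = f * homothety r.
Proof. by apply: HomP => m /=; rewrite linearZ. Qed.

Lemma homothetyM r s : homothety (r * s) = homothety r * homothety s.
Proof. by apply: HomP => m /=; rewrite scalerA. Qed.

Variable p : Spec R.
Let B : pzRingType := alg_at p (End_alg M).

Definition to_alg_at (f : End M) : B := @frac _ _ (End_alg M) f (denom1 (prime_compl p)).

Lemma to_alg_at_zmod : zmod_morphism to_alg_at.
Proof.
move=> f g; rewrite /to_alg_at.
rewrite -[X in _ = _ + X]/(loc_opp (frac _ _)) loc_oppE [RHS]fracD.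
by apply: frac_eq; rewrite /= mul1r !scale1r.
Qed.

Lemma to_alg_at_monoid : monoid_morphism to_alg_at.
Proof.
split=> // f g; rewrite /to_alg_at [RHS]fracM.
by apply: frac_eq; rewrite /= mul1r !scale1r.
Qed.

HB.instance Definition _ :=
  GRing.isZmodMorphism.Build (End M) B to_alg_at to_alg_at_zmod.
HB.instance Definition _ :=
  GRing.isMonoidMorphism.Build (End M) B to_alg_at to_alg_at_monoid.

Lemma to_alg_at_eq f g : to_alg_at f = to_alg_at g ->
  exists2 u, ~ (p : set R) u & u *: f = u *: g.
Proof.
move=> /fracP[u /=]; rewrite !scale1r => e.
by exists (sval u) => //; exact: denomP.
Qed.

Lemma homothety_at_central r (b : B) :
  to_alg_at (homothety r) * b = b * to_alg_at (homothety r).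
Proof.
move: b; elim/locW=> f s; rewrite [LHS]fracM [RHS]fracM.
apply: frac_eq => /=; rewrite mulr1 mul1r; congr (_ *: _).
exact: homothetyC.
Qed.

Local Notation io := (map_mx to_alg_at).

Lemma to_alg_at_mx_eq k l (X Z : 'M[End M]_(k, l)) :
  map_mx to_alg_at X = map_mx to_alg_at Z ->
  exists2 u, ~ (p : set R) u & homothety u *: X = homothety u *: Z.
Proof.
move=> /matrixP e.
have [|ij u v|u pu uP] := @common_denominator R p ('I_k * 'I_l)%type
    (fun ij u => u *: X ij.1 ij.2 = u *: Z ij.1 ij.2).
- move=> [i j] /=; apply: to_alg_at_eq.
  by have := e i j; rewrite !mxE.
- by rewrite -!scalerA => ->.
exists u => //; apply/matrixP => i j; rewrite !mxE !homothetyE; exact: (uP (i, j)).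
Qed.

Lemma mx_denominator k l (X : 'M[B]_(k, l)) :
  exists2 s, ~ (p : set R) s &
    exists Z, to_alg_at (homothety s) *: X = map_mx to_alg_at Z.
Proof.
have [|ij u v [f fE]|s ps sP] := @common_denominator R p ('I_k * 'I_l)%type
    (fun ij s => exists f, to_alg_at (homothety s) * X ij.1 ij.2 = to_alg_at f).
- move=> [i j] /=; elim/locW: (X i j) => f s.
  exists (sval s); first exact: denomP.
  exists f; rewrite [LHS]fracM; apply: frac_eq => /=.
  by rewrite mul1r scale1r; exact: homothetyE.
- exists (homothety u * f); rewrite homothetyM !rmorphM /= -fE.
  by rewrite mulrA.
have [f fP] := choice sP.
exists s => //; exists (\matrix_(i, j) f (i, j)).
by apply/matrixP => i j; rewrite !mxE; exact: (fP (i, j)).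
Qed.

(* The hypothesis makes [d] annihilate the relations between the rows of [Y]
   modulo those given by the finitely many rows of [d - Y W]; this lets
   [row_space_splitting] descend from the localization. *)
Lemma local_splitting (l k : nat) (Y : 'M[End M]_(l, k)) (W : 'M_(k, l)) (d : R) :
  (forall X : lmodType B, proj_dim_le X 1) ->
  Y *m W *m Y = homothety d *: Y ->
  exists2 s, ~ (p : set R) s & exists E : 'M[End M]_l,
    E *m Y = homothety s *: Y /\ homothety d *: E = Y *m W *m E.
Proof.
move=> gld YWY.
have ioZ r n m (X : 'M_(n, m)) : io (homothety r *: X) = to_alg_at (homothety r) *: io X.
  exact: map_mxZ.
have ioM n m q (X : 'M_(n, m)) (Z : 'M_(m, q)) : io (X *m Z) = io X *m io Z.
  exact: map_mxM.
have [E1 [EY kerE]] := row_space_splitting (io Y) gld.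
(* The rows of C = d - Y W kill Y, so they kill [E1] by [kerE]. *)
have dE : to_alg_at (homothety d) *: E1 = io Y *m io W *m E1.
  apply/row_matrixP => i; apply/eqP; rewrite -subr_eq0 -linearB/=.
  pose C := to_alg_at (homothety d) *: 1%:M - io Y *m io W.
  have CE n (X : 'M_(l, n)) :
      to_alg_at (homothety d) *: X - io Y *m io W *m X = C *m X.
    by rewrite mulmxBl -scalemxAl mul1mx.
  rewrite CE row_mul; apply/eqP/kerE.
  by rewrite -row_mul -CE -!ioM YWY ioZ subrr linear0.
have [s ps [E' E'E]] := mx_denominator E1.
have [|u pu uE] := @to_alg_at_mx_eq _ _ (E' *m Y) (homothety s *: Y).
  by rewrite ioM -E'E -scalemxAl EY ioZ.
have [|v pv vE] := @to_alg_at_mx_eq _ _ (homothety d *: E') (Y *m W *m E').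
  rewrite ioZ !ioM -E'E -central_scalemxAr -?dE; last first.
    exact: homothety_at_central.
  by rewrite !scalerA homothety_at_central.
(* [s] clears the denominators of [E1]; [u] and [v] make the two identities hold before
   localization. *)
exists (v * (u * s)); first by do 2 case/prime_mul => //.
exists (homothety (v * u) *: E'); split.
  by rewrite -scalemxAl homothetyM -scalerA uE !scalerA -!homothetyM mulrA.
rewrite -central_scalemxAr; last exact: homothetyC.
rewrite scalerA homothetyC -scalerA [v * u]mulrC !homothetyM -!scalerA.
by rewrite vE.
Qed.
End LocalSplitting.

(** * The normalization *)

(** An integral equation for a / b with denominators cleared, so that it makes sense without
    inverting b. *)
Definition integral_fraction (R : comPzRingType) (a b : R) : Prop :=
  exists (n : nat) (c : 'I_n -> R),
    a ^+ n + \sum_(i < n) c i * a ^+ i * b ^+ (n - i) = 0.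

Lemma clear_denominators (R Q : comPzRingType) (f : {rmorphism R -> Q}) (q : Q)
    (a b : R) n (c : 'I_n -> R) : f b * q = f a ->
  f b ^+ n * (q ^+ n + \sum_(i < n) f (c i) * q ^+ i) =
  f (a ^+ n + \sum_(i < n) c i * a ^+ i * b ^+ (n - i)).
Proof.
move=> bq; rewrite !(rmorphD, rmorph_sum, rmorphXn) -bq mulrDr -exprMn.
congr (_ + _); rewrite mulr_sumr; apply: eq_bigr => i _.
have -> : f b ^+ n = f b ^+ i * f b ^+ (n - i) by rewrite -exprD subnKC// ltnW.
by rewrite !(rmorphM, rmorphXn) -bq exprMn; ring.
Qed.

Section Normalization.
Variable R : comPzRingType.

Let S := normalization R.
Let toQ : {rmorphism R -> total_quotient_ring R} := to_loc_ring (nonzerodivisors R).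
Let tn : {rmorphism R -> S} := @to_normalization R.

Lemma denom_nonzerodivisor (u : nonzerodivisors R) : nonzerodivisor (sval u).
Proof. by case: u => u /=; rewrite inE. Qed.

Lemma to_total_quotient_eq0 r : toQ r = 0 -> r = 0.
Proof.
rewrite -[0]/(rfrac 0 (denom1 _)) => /rfracP[u /=].
rewrite !mul1r mulr0; exact: denom_nonzerodivisor.
Qed.

Lemma total_quotient_inverse b : nonzerodivisor b -> exists v, v * toQ b = 1.
Proof.
move=> br; pose u : nonzerodivisors R := exist _ b (mem_set br).
exists (rfrac 1 u : total_quotient_ring R).
rewrite rfracM; apply/rfracP; exists (denom1 _) => /=.
by rewrite !mul1r !mulr1.
Qed.

Lemma total_quotient_fraction (q : total_quotient_ring R) :
  exists a b, nonzerodivisor b /\ toQ b * q = toQ a.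
Proof.
move: q; apply: loc_ringW => a b; exists a, (sval b); split; first exact: denom_nonzerodivisor.
rewrite rfracM; apply/rfracP; exists (denom1 _) => /=.
by rewrite !mul1r.
Qed.

Lemma to_normalization_reg b (x : S) : nonzerodivisor b -> tn b * x = 0 -> x = 0.
Proof.
move=> /total_quotient_inverse[v vb] e; apply: val_inj.
have bx : toQ b * val x = 0 by exact: (congr1 val e).
by rewrite -[LHS]mul1r -vb -mulrA bx mulr0.
Qed.

Lemma to_normalization_regI b (x y : S) :
  nonzerodivisor b -> tn b * x = tn b * y -> x = y.
Proof.
move=> br e; apply/eqP; rewrite -subr_eq0; apply/eqP/(to_normalization_reg br).
by rewrite mulrBr e subrr.
Qed.

Lemma to_normalization_inj : injective tn.
Proof.
move=> r s /(congr1 val)/= e; apply/eqP; rewrite -subr_eq0.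
by apply/eqP/to_total_quotient_eq0; rewrite rmorphB /= e subrr.
Qed.

Lemma normalization_fraction (x : S) :
  exists a b, [/\ nonzerodivisor b, tn b * x = tn a & integral_fraction a b].
Proof.
case: x => q q_int; have [a [b [br bq]]] := total_quotient_fraction q.
exists a, b; split=> //; first exact: val_inj.
have /asboolP[n [c e]] := q_int; exists n, c; apply: to_total_quotient_eq0.
by rewrite -(clear_denominators _ bq) e mulr0.
Qed.

Lemma integral_fraction_normalization a b : nonzerodivisor b ->
  integral_fraction a b -> exists x : S, tn b * x = tn a.
Proof.
move=> br [n [c e]]; have [v vb] := total_quotient_inverse br.
have bq : toQ b * (v * toQ a) = toQ a by rewrite mulrA [_ * v]mulrC vb mul1r.
suff q_int : v * toQ a \in integral_closure toQ.
  by exists (Normalization q_int); exact: val_inj.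
apply/asboolP; exists n, c; rewrite -[LHS]mul1r -[1 in LHS](expr1n _ n) -vb exprMn -mulrA.
by rewrite (clear_denominators _ bq) e rmorph0 mulr0.
Qed.
End Normalization.

Lemma Cayley_Hamilton_coefficients (R : comPzRingType) n (C : 'M[R]_n.+1) :
  exists c : 'I_n.+1 -> R, C ^+ n.+1 + \sum_i c i *: C ^+ i = 0.
Proof.
(* The characteristic polynomial is formed over a nontrivial ring, so the zero ring is settled
   first. *)
have [R0|R1] := eqVneq (1 : R) 0.
  exists (fun=> 0); rewrite -[LHS]scale1r R0; exact: scale0r.
pose R' : comNzRingType :=
  HB.pack (R : Type) R (GRing.PzSemiRing_isNonZero.Build R R1).
pose C' : 'M[R']_n.+1 := C.
exists (fun i => (char_poly C')`_i).
have lead1 : (char_poly C')`_n.+1 = 1.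
  by have /monicP := char_poly_monic C'; rewrite lead_coefE size_char_poly.
have hornerZX i : horner_mx C' ((char_poly C')`_i *: 'X^i) = (char_poly C')`_i *: C' ^+ i.
  by rewrite linearZ rmorphXn /= horner_mx_X.
have := Cayley_Hamilton C'.
rewrite -[char_poly C' in X in X -> _]coefK poly_def size_char_poly.
rewrite rmorph_sum big_ord_recr/= hornerZX lead1 scale1r addrC => CH.
rewrite -[RHS]CH; congr (_ + _).
by apply: eq_bigr => i _; rewrite hornerZX.
Qed.

(** The determinant trick: [f] plays the role of a / e. If D is the matrix of [f] on the generators,
    then a^i acts on them as e^i D^i, and the Cayley-Hamilton equation of D becomes, by
    faithfulness, an equation for a and e. *)
Lemma integral_fraction_of_End (R : comPzRingType) (M : lmodType R)
    (a e : R) (f : End M) :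
  finitely_generated M -> faithful M -> homothety M a = e *: f ->
  integral_fraction a e.
Proof.
move=> [[|l] [x x_gen]] M_faithful aef.
  (* Without generators M is zero, so faithfulness forces 1 = 0 and the equation of degree 0
     holds. *)
  exists 0%N, (fun=> 0); rewrite big_ord0 addr0; apply: M_faithful => m.
  by have [c ->] := x_gen m; rewrite big_ord0 scaler0.
have am m : a *: m = e *: f m.
  by rewrite -[a *: m]/(homothety M a m) aef.
have [C CE] := choice (fun j => x_gen (f (x j))).
pose D : 'M[R]_l.+1 := \matrix_(j, i) C j i.
have aX i j : a ^+ i *: x j = e ^+ i *: \sum_h (D ^+ i) j h *: x h.
  elim: i j => [|i IH] j.
    rewrite !expr0 !scale1r (bigD1 j)//= mxE eqxx scale1r big1 ?addr0// => h.
    by rewrite mxE eq_sym => /negPf ->; rewrite scale0r.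
  transitivity (e *: \sum_g C j g *: (a ^+ i *: x g)).
    rewrite exprSr -scalerA am CE scalerA mulrC -scalerA; congr (_ *: _).
    by rewrite scaler_sumr; apply: eq_bigr => g _; rewrite !scalerA mulrC.
  rewrite exprS -scalerA; congr (_ *: _).
  transitivity (e ^+ i *: \sum_g C j g *: \sum_h (D ^+ i) g h *: x h).
    rewrite scaler_sumr; apply: eq_bigr => g _.
    by rewrite IH !scalerA mulrC.
  congr (_ *: _); under eq_bigr do rewrite scaler_sumr.
  rewrite exchange_big; apply: eq_bigr => h _.
  rewrite exprS mxE scaler_suml; apply: eq_bigr => g _.
  by rewrite scalerA mxE.
have [c cE] := Cayley_Hamilton_coefficients D.
exists l.+1, c; apply: M_faithful => m; have [t ->] := x_gen m.
rewrite scaler_sumr big1// => j _; rewrite scalerA mulrC -scalerA.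
suff -> : (a ^+ l.+1 + \sum_(i < l.+1) c i * a ^+ i * e ^+ (l.+1 - i)) *: x j = 0.
  exact: scaler0.
transitivity (e ^+ l.+1 *:
    \sum_h (D ^+ l.+1 + \sum_i c i *: D ^+ i) j h *: x h); last first.
  by rewrite cE big1 ?scaler0// => h _; rewrite mxE scale0r.
rewrite scalerDl aX scaler_suml.
under [in RHS]eq_bigr do rewrite mxE scalerDl.
rewrite big_split/= scalerDr; congr (_ + _).
under [in RHS]eq_bigr do rewrite summxE scaler_suml.
rewrite exchange_big scaler_sumr; apply: eq_bigr => i _.
rewrite mulrAC -scalerA aX scalerA -mulrA -exprD subnK; last exact: ltnW.
rewrite mulrC -scalerA scaler_sumr; congr (_ *: _); apply: eq_bigr => h _.
by rewrite mxE scalerA.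
Qed.

(** * Integral fractions a / b with (a, b) locally invertible *)

Section OneVariableExtension.
Variables (R : comPzRingType) (M : lmodType R) (a b s : R).
Variables (alpha beta : 'I_2 -> End M).
Hypothesis b_reg : forall f : End M, b *: f = 0 -> f = 0.
Hypothesis beta_sum : a *: beta 0 + b *: beta 1 = homothety M (s * b).
Hypothesis alphaE : forall j, b *: alpha j = a *: beta j.

(* [(a / b) ^+ i * f] lies in [End M] for all [i <= n]. *)
Let stable_upto (n : nat) (f : End M) :=
  forall i, (i <= n)%N -> exists g, a ^+ i *: f = b ^+ i *: g.

(** Put q = a / b. The hypotheses read q beta_0 + beta_1 = s and alpha_j = q beta_j. Hence q^(i+1)
    beta_j f = alpha_j (q^i f). *)
Lemma stable_upto_mul n f j : stable_upto n f -> stable_upto n.+1 (beta j * f).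
Proof.
move=> fn [_|i /fn[g ag]]; first by exists (beta j * f); rewrite !expr0.
exists (alpha j * g).
rewrite exprSr -scalerA End_scalerAl -alphaE -End_scalerAl scalerA mulrC -scalerA.
by rewrite End_scalerAr ag -End_scalerAr scalerA -exprS.
Qed.

(** Because s q^i f = q^(i+1) beta_0 f + q^i beta_1 f. *)
Lemma stable_of_mul f : (forall j n, stable_upto n (beta j * f)) ->
  forall n, stable_upto n (s *: f).
Proof.
move=> bf n i _; have [g gE] := bf 0 i.+1 i.+1 (leqnn _).
have [h hE] := bf 1 i i (leqnn _).
exists (g + h); apply/eqP; rewrite -subr_eq0; apply/eqP/b_reg.
rewrite scalerBr; apply/eqP; rewrite subr_eq0; apply/eqP.
transitivity (a ^+ i *: (homothety M (s * b) * f)).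
  by rewrite homothetyE !scalerA; congr (_ *: _); ring.
rewrite -beta_sum mulrDl scalerDr -!End_scalerAl !scalerA -exprSr gE.
by rewrite mulrC -[(b * _) *: _]scalerA hE !scalerDr !scalerA -!exprS.
Qed.

(** The integral equation writes q^i f, for i at least n, through lower powers of q. *)
Lemma stable_of_relation n (c : 'I_n -> R) f :
  a ^+ n + \sum_(i < n) c i * a ^+ i * b ^+ (n - i) = 0 ->
  stable_upto n.-1 f -> forall m, stable_upto m f.
Proof.
move=> ab fn m i _; elim/ltn_ind: i => i IH.
have [/fn//|ni] := leqP i n.-1.
have {}ni : (n <= i)%N by case: (n) ni.
have ex (t : 'I_n) : exists g, a ^+ (t + (i - n)) *: f = b ^+ (t + (i - n)) *: g.
  by apply: IH; rewrite -[X in (_ < X)%N](subnKC ni) ltn_add2r.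
have [g gE] := choice ex.
exists (- \sum_t c t *: g t).
have /eqP := ab; rewrite addr_eq0 => /eqP an.
rewrite -[in LHS](subnKC ni) exprD an mulNr scaleNr scalerN; congr (- _).
rewrite mulr_suml scaler_suml scaler_sumr; apply: eq_bigr => t _.
transitivity ((c t * b ^+ (n - t)) *: (a ^+ (t + (i - n)) *: f)).
  by rewrite scalerA exprD; congr (_ *: _); ring.
rewrite gE !scalerA; congr (_ *: _).
rewrite -mulrA -exprD addnA subnK 1?ltnW// subnKC//.
exact: mulrC.
Qed.

(** Each factor s is traded for a left multiplication by some beta_j, which gains one more power of
    q. Starting from 1, which is stable up to 0, n factors are enough to reach the range where the
    integral equation takes over. *)
Lemma multiple_of_relation n (c : 'I_n -> R) :
  a ^+ n + \sum_(i < n) c i * a ^+ i * b ^+ (n - i) = 0 ->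
  exists g, (s ^+ n * a) *: (1 : End M) = b *: g.
Proof.
move=> ab.
have stable m : forall k f, (n <= k + m.+1)%N -> stable_upto k f ->
    forall i, stable_upto i (s ^+ m *: f).
  elim: m => [|m IH] k f nk fk.
    rewrite expr0 scale1r; apply: stable_of_relation ab _ => i ik.
    apply: fk; apply: leq_trans ik _; case: (n) nk => // n'.
    by rewrite addn1 ltnS.
  rewrite exprS -scalerA; apply: stable_of_mul => j i.
  rewrite -End_scalerAr; apply: (IH k.+1).
    by rewrite addSnnS.
  exact: stable_upto_mul.
have [||g gE] := stable n 0%N 1 _ _ 1%N 1%N isT.
- by rewrite add0n.
- by move=> i; rewrite leqn0 => /eqP ->; exists 1; rewrite !expr0.
by exists g; rewrite mulrC -scalerA -[a]expr1 gE expr1.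
Qed.
End OneVariableExtension.

(** * The action of the normalization on M *)

Section Semilinear.
Variables (R : comPzRingType) (M : lmodType R).
Let S := normalization R.
Let tn : {rmorphism R -> S} := @to_normalization R.

Definition semilinear (mu : M -> S) : Prop :=
  forall r m n, mu (r *: m + n) = tn r * mu m + mu n.

Variable mu : M -> S.
Hypothesis mu_lin : semilinear mu.

Lemma semilinear0 : mu 0 = 0.
Proof.
apply: (addrI (mu 0)); have := mu_lin 1 0 0.
by rewrite scale1r rmorph1 mul1r !addr0.
Qed.

Lemma semilinearD m n : mu (m + n) = mu m + mu n.
Proof. by have := mu_lin 1 m n; rewrite scale1r rmorph1 mul1r. Qed.

Lemma semilinearZ r m : mu (r *: m) = tn r * mu m.
Proof. by rewrite -[r *: m]addr0 mu_lin semilinear0 addr0. Qed.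

Lemma semilinear_sum (I : finType) (F : I -> M) : mu (\sum_i F i) = \sum_i mu (F i).
Proof. exact: (big_morph mu semilinearD semilinear0). Qed.
End Semilinear.


Lemma fraction_add (R Q : comPzRingType) (f : {rmorphism R -> Q}) (x y : Q)
    (a b c d r : R) : f b * x = f a -> f d * y = f c ->
  f (b * d) * (f r * x + y) = f (r * d * a + b * c).
Proof. by move=> bx dy; rewrite !(rmorphD, rmorphM) -bx -dy; ring. Qed.

Section Action.
Variables (R : comPzRingType) (M : lmodType R).
Hypotheses (R_noetherian : noetherian R) (M_torsion_free : torsion_free M).
Hypothesis M_nonsingular : nonsingular_order (End_alg M).

Let S := normalization R.
Let tn : {rmorphism R -> S} := @to_normalization R.

Lemma End_torsion_free (d : R) (f : End M) :
  nonzerodivisor d -> d *: f = 0 -> f = 0.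
Proof.
move=> dr df; apply: HomP => m; apply: (M_torsion_free dr).
by rewrite -[LHS]/((d *: f) m) df.
Qed.

Lemma End_regI (d : R) (f g : End M) : nonzerodivisor d -> d *: f = d *: g -> f = g.
Proof.
move=> dr e; apply/eqP; rewrite -subr_eq0; apply/eqP/(End_torsion_free dr).
by rewrite scalerBr e subrr.
Qed.

Lemma End_divisible (d : R) (f : End M) : nonzerodivisor d ->
  (forall p : Spec R,
    (forall X : lmodType (alg_at p (End_alg M)), proj_dim_le X 1) ->
    exists2 t, ~ (p : set R) t & exists g : End M, t *: f = d *: g) ->
  exists g : End M, f = d *: g.
Proof.
move=> dr; apply: (divisible_locally R_noetherian M_nonsingular).
by move=> v; exact: End_torsion_free.
Qed.

Lemma prime_exp (p : Spec R) s n : ~ (p : set R) s -> ~ (p : set R) (s ^+ n).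
Proof.
move=> ps; elim: n => [|n IH]; first by rewrite expr0; exact: prime_proper.
by rewrite exprS => /prime_mul[].
Qed.

(** At a prime to be tested the left ideal (a, b) of A_p is projective, and a splitting of it
    supplies the [alpha] and [beta] of [multiple_of_relation]. *)
Lemma integral_fraction_divisible (a b : R) : nonzerodivisor b ->
  integral_fraction a b -> exists g : End M, homothety M a = b *: g.
Proof.
move=> br [n [c ab]]; apply: (End_divisible br) => p gld.
(* [Y] is the column (a, b) and [W] the row (0, 1), so that Y W Y = b Y. *)
pose Y : 'M[End M]_(2, 1) := \matrix_(i, j) homothety M (if i == 0 then a else b).
pose W : 'M[End M]_(1, 2) := \matrix_(i, j) (if j == 0 then 0 else 1).
have WE k (X : 'M[End M]_(2, k)) i j : (Y *m W *m X) i j = Y i 0 * X 1 j.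
  rewrite -mulmxA mxE big_ord1; congr (_ * _).
  by rewrite mxE big_ord_recl big_ord1 !mxE/= mul0r add0r mul1r; congr (X _ _); apply: val_inj.
have [|s ps [E [EY bE]]] := local_splitting (d := b) (Y := Y) (W := W) gld.
  apply/matrixP => i j; rewrite WE [RHS]mxE (ord1 j) ![Y _ _]mxE /=.
  exact: homothetyC.
have [g gE] : exists g, (s ^+ n * a) *: (1 : End M) = b *: g.
  (* Row 1 of E Y = s Y is the relation between the [beta], and row 0 of b E = Y W E says that b
     E_0j = a E_1j. *)
  apply: (@multiple_of_relation R M a b s (fun j => E 0 j) (fun j => E 1 j) _ _ _ n c) => //.
  - by move=> f; exact: End_torsion_free.
  - have := congr1 (fun X : 'M_(2, 1) => X 1 0) EY.
    rewrite [LHS]mxE [RHS]mxE big_ord_recl big_ord1 ![Y _ _]mxE.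
    rewrite (_ : lift ord0 ord0 = 1); last exact: val_inj.
    rewrite [X in _ = X -> _]homothetyE.
    rewrite -[X in X + _ = _ -> _]homothetyC -[X in _ + X = _ -> _]homothetyC.
    rewrite [X in X + _ = _ -> _]homothetyE [X in _ + X = _ -> _]homothetyE => ->.
    by rewrite /homothety scalerA.
  - move=> j; have := congr1 (fun X : 'M_2 => X 0 j) bE.
    by rewrite WE !mxE/= !homothetyE.
exists (s ^+ n); first exact: prime_exp.
by exists g; rewrite -gE /homothety scalerA.
Qed.

(** One fraction for [x] produces [f]; cancelling its denominator shows that [f] satisfies the
    equation of every other fraction, which is what makes the action additive. *)
Lemma action_exists (x : S) : exists f : End M,
  forall a b, nonzerodivisor b -> tn b * x = tn a -> b *: f = homothety M a.
Proof.
have [a [b [br bx ab]]] := normalization_fraction x.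
have [f fE] := integral_fraction_divisible br ab; exists f => a' b' br' bx'.
apply: (End_regI br); rewrite scalerA mulrC -scalerA -fE /homothety !scalerA.
congr (_ *: _); apply: (@to_normalization_inj R).
by rewrite !rmorphM /= -/tn -bx -bx' mulrCA.
Qed.

Definition action (x : S) : End M := sval (cid (action_exists x)).

Lemma actionE x a b :
  nonzerodivisor b -> tn b * x = tn a -> b *: action x = homothety M a.
Proof. by rewrite /action; case: cid => f /= ; exact. Qed.

Lemma actionP r x y : action (tn r * x + y) = r *: action x + action y.
Proof.
have [a [b [br bx _]]] := normalization_fraction x.
have [c [d [dr dy _]]] := normalization_fraction y.
have bdr := nonzerodivisorM br dr; apply: (End_regI bdr).
rewrite (@actionE _ (r * d * a + b * c))//.
  have -> : homothety M (r * d * a + b * c) =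
      (r * d) *: homothety M a + b *: homothety M c.
    by rewrite /homothety !scalerA scalerDl.
  rewrite -(actionE br bx) -(actionE dr dy) scalerDr !scalerA.
  by congr (_ *: _ + _); ring.
exact: fraction_add.
Qed.

Lemma action_to_normalization r : action (tn r) = homothety M r.
Proof.
by rewrite -(@actionE (tn r) r 1) ?scale1r ?rmorph1 ?mul1r//; exact: nonzerodivisor1.
Qed.

Lemma semilinear_action (mu : M -> S) x m :
  semilinear mu -> mu (action x m) = x * mu m.
Proof.
move=> mu_lin; have [a [b [br bx _]]] := normalization_fraction x.
apply: (to_normalization_regI br); rewrite -(semilinearZ mu_lin) mulrA bx.
by rewrite -[b *: _]/((b *: action x) m) (actionE br bx) -(semilinearZ mu_lin).
Qed.
End Action.

(** * Dual bases at primes of height at most 1 *)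

Section Rank1.
Variables (R : comPzRingType) (M : lmodType R) (lam : Hom M R^o) (m : M).

Definition dyad_fun (y : M) : M := (lam y : R) *: m.
Lemma dyad_linear : linear dyad_fun.
Proof. by move=> a y z; rewrite /dyad_fun linearP scalerDl scalerA. Qed.
HB.instance Definition _ := GRing.isLinear.Build R M M *:%R dyad_fun dyad_linear.
Definition dyad : End M := (dyad_fun : {linear M -> M}).
Lemma dyadE y : dyad y = (lam y : R) *: m. Proof. by []. Qed.
End Rank1.

Lemma End_mulmxE (R : comPzRingType) (M : lmodType R) n m q
    (X : 'M[End M]_(n, m)) (Z : 'M[End M]_(m, q)) i j (y : M) :
  (X *m Z) i j y = \sum_a X i a (Z a j y).
Proof. by rewrite mxE [LHS]hom_sumE. Qed.

Lemma homothety_mxE (R : comPzRingType) (M : lmodType R) n m r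
    (X : 'M[End M]_(n, m)) i j (y : M) :
  (homothety M r *: X) i j y = r *: X i j y.
Proof. by rewrite mxE homothetyE. Qed.

Section LocalDualBasis.
Variables (R : comPzRingType) (M : lmodType R).
Hypotheses (R_noetherian : noetherian R) (R_reduced : reduced R).
Hypotheses (M_faithful : faithful M) (M_torsion_free : torsion_free M).
Hypothesis M_nonsingular : nonsingular_order (End_alg M).
Variables (l : nat) (x : 'I_l -> M) (d : R) (lam : 'I_l -> Hom M R^o).
Hypothesis x_gen : forall m, exists a : 'I_l -> R, m = \sum_(j < l) a j *: x j.
Hypothesis d_reg : nonzerodivisor d.
Hypothesis d_lam : forall m, d *: m = \sum_(j < l) (lam j m : R) *: x j.

Let S := normalization R.
Let tn : {rmorphism R -> S} := @to_normalization R.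
Local Notation act := (action R_noetherian M_torsion_free M_nonsingular).

Lemma torsion_free_regI (e : R) (m n : M) :
  nonzerodivisor e -> e *: m = e *: n -> m = n.
Proof.
move=> er emn; apply/eqP; rewrite -subr_eq0; apply/eqP/(M_torsion_free er).
by rewrite scalerBr emn subrr.
Qed.

Lemma End_division (e : R) (g : End M) : nonzerodivisor e ->
  (forall m, exists n, g m = e *: n) -> exists f : End M, g = e *: f.
Proof.
move=> er /choice[f fE].
have f_lin : linear f.
  move=> a u v; apply: (torsion_free_regI er).
  by rewrite scalerDr scalerA mulrC -scalerA -!fE linearP.
have [h hE] : exists h : End M, h =1 f by exact: linear_function_exists.
by exists h; apply: HomP => m; rewrite fE -hE.
Qed.

Lemma semilinear_division (e : R) (theta : M -> S) :
  nonzerodivisor e -> semilinear theta ->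
  (forall m, exists w, theta m = tn e * w) ->
  exists2 nu, semilinear nu & forall m, theta m = tn e * nu m.
Proof.
move=> er th_lin /choice[nu nuE]; exists nu => // r m n.
apply: (to_normalization_regI er); rewrite -/tn -nuE th_lin !nuE.
by rewrite mulrDr !mulrA [tn r * _]mulrC.
Qed.

(** If c kills every value of the [lam i], then c d kills M, so c d = 0 by faithfulness and c =
    0. *)
Lemma trace_ideal_reg : exists (e : R) (z : 'I_l -> M),
  nonzerodivisor e /\ e = \sum_i (lam i (z i) : R).
Proof.
suff [e [z ez] er] : exists2 e, [set t | exists z : 'I_l -> M,
    t = \sum_i (lam i (z i) : R)] e & nonzerodivisor e by exists e, z.
apply: nonzerodivisor_in_ideal => //.
  split.
  - by exists (fun=> 0); rewrite big1// => i _; rewrite linear0.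
  - move=> _ _ [z ->] [w ->]; exists (fun i => z i + w i).
    by rewrite -big_split/=; apply: eq_bigr => i _; rewrite linearD.
  - move=> a _ [z ->]; exists (fun i => a *: z i).
    by rewrite mulr_sumr; apply: eq_bigr => i _; rewrite linearZ.
move=> c cI; apply: d_reg; apply: M_faithful => m.
rewrite mulrC -scalerA d_lam scaler_sumr big1// => j _.
rewrite scalerA cI ?scale0r//; exists (fun i => if i == j then m else 0).
rewrite (bigD1 j)//= eqxx big1 ?addr0// => i /negPf ->.
exact: linear0.
Qed.

(* [M_p] is a projective module over the hereditary ring [End M_p], hence a
   generator over the center of that ring. *)
Lemma generator_at (p : Spec R) :
  (forall X : lmodType (alg_at p (End_alg M)), proj_dim_le X 1) ->
  exists2 s, ~ (p : set R) s & exists nu : 'I_l -> M -> S,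
    (forall j, semilinear (nu j)) /\ \sum_j nu j (x j) = tn s.
Proof.
move=> gld; have [e [z [er ez]]] := trace_ideal_reg.
have [zeta zetaE] := choice (fun i => x_gen (z i)).
(* Composing with f on the left turns the dyad of m into that of f m, so the row space of [Y] is a
   copy of M as an A-module. [W] holds the coordinates of the [z i], and the choice of [e] gives Y W
   Y = e Y. *)
pose Y : 'M[End M]_l := \matrix_(j, i) dyad (lam i) (x j).
pose W : 'M[End M]_l := \matrix_(i, a) homothety M (zeta i a).
have YWE q (X : 'M[End M]_(l, q)) j b y : (Y *m W *m X) j b y =
    (\sum_i (lam i (\sum_a zeta i a *: X a b y) : R)) *: x j.
  rewrite -mulmxA End_mulmxE scaler_suml; apply: eq_bigr => i _.
  rewrite mxE End_mulmxE dyadE; congr ((lam i _ : R) *: _).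
  by apply: eq_bigr => a _; rewrite mxE.
have [|s ps [E [EY eE]]] := local_splitting (d := e) (Y := Y) (W := W) gld.
  apply/matrixP => j b; apply: HomP => y; rewrite YWE homothety_mxE mxE.
  rewrite dyadE scalerA; congr (_ *: _).
  rewrite ez mulr_suml; apply: eq_bigr => i _.
  under eq_bigr do rewrite mxE dyadE scalerA mulrC -scalerA.
  by rewrite -scaler_sumr -zetaE linearZ mulrC.
have Ex j : \sum_a E j a (x a) = s *: x j.
  apply: (torsion_free_regI er); rewrite scalerA mulrC -scalerA.
  have EYi i : (lam i (z i) : R) *: \sum_a E j a (x a) = s *: ((lam i (z i) : R) *: x j).
    have := congr1 (fun X : 'M[End M]_l => X j i (z i)) EY.
    rewrite End_mulmxE homothety_mxE mxE => <-.
    rewrite scaler_sumr; apply: eq_bigr => a _.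
    by rewrite mxE -linearZ.
  rewrite {1}ez scaler_suml; under eq_bigr do rewrite EYi.
  by rewrite -scaler_sumr -scaler_suml -ez.
pose tau a (y : M) : R := \sum_i (lam i (\sum_b zeta i b *: E b a y) : R).
have tauE j a y : e *: E j a y = tau a y *: x j.
  by rewrite -YWE -eE homothety_mxE.
have tau_lin a r m n : tau a (r *: m + n) = r * tau a m + tau a n.
  rewrite /tau mulr_sumr -big_split/=; apply: eq_bigr => i _.
  rewrite -[r * _]/(r *: (lam i _)) -linearP; congr (lam i _).
  rewrite scaler_sumr -big_split/=; apply: eq_bigr => b _.
  by rewrite linearP scalerDr !scalerA mulrC.
(* By [tauE], tau_a(m) / e acts on M as an endomorphism sending each x_j to E_ja(m); by the
   determinant trick it is integral, hence lies in S. *)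
have ex_nu a m : exists w : S, tn (tau a m) = tn e * w.
  have [|f fE] := @End_division e (homothety M (tau a m)) er.
    move=> n; have [c ->] := x_gen n; exists (\sum_j c j *: E j a m).
    rewrite scaler_sumr -[LHS]/(tau a m *: _) scaler_sumr; apply: eq_bigr => j _.
    rewrite [RHS]scalerA [e * _]mulrC -[RHS]scalerA tauE !scalerA.
    by rewrite mulrC.
  have [|w wE] := integral_fraction_normalization er
    (integral_fraction_of_End _ M_faithful fE).
    by exists l, x.
  by exists w.
have [nu nuP] : exists nu : 'I_l -> M -> S, forall a,
    semilinear (nu a) /\ forall m, tn (tau a m) = tn e * nu a m.
  have ex a : exists nu : M -> S, semilinear nu /\ forall m, tn (tau a m) = tn e * nu m.
    have [|nu nu_lin nuE] := @semilinear_division e (fun m => tn (tau a m)) er _ (ex_nu a).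
      by move=> r m n; rewrite tau_lin rmorphD rmorphM.
    by exists nu.
  by have [nu nuP] := choice ex; exists nu.
exists s => //; exists nu; split=> [j|]; first exact: (nuP j).1.
apply: (to_normalization_regI er); rewrite mulr_sumr.
under eq_bigr do rewrite -(nuP _).2.
rewrite -rmorph_sum -rmorphM; congr (tn _).
apply/eqP; rewrite -subr_eq0; apply/eqP/M_faithful => m.
have [c ->] := x_gen m; rewrite scaler_sumr big1// => j _.
rewrite scalerA mulrC -scalerA scalerBl scaler_suml.
under eq_bigr do rewrite -tauE.
by rewrite -scaler_sumr Ex scalerA subrr scaler0.
Qed.

Lemma act0 : act 0 = 0.
Proof.
apply: (addrI (act 0)); have := actionP R_noetherian M_torsion_free M_nonsingular 1 0 0.
by rewrite rmorph1 mul1r scale1r !addr0.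
Qed.

Lemma actD y w : act (y + w) = act y + act w.
Proof.
have := actionP R_noetherian M_torsion_free M_nonsingular 1 y w.
by rewrite rmorph1 mul1r scale1r.
Qed.

Lemma actZ r y : act (tn r * y) = r *: act y.
Proof.
by rewrite -[tn r * y]addr0 [LHS]actionP act0 addr0.
Qed.

Lemma act_sumE (I : finType) (F : I -> S) m :
  act (\sum_i F i) m = \sum_i act (F i) m.
Proof. by rewrite (big_morph _ actD act0) [LHS]hom_sumE. Qed.

Lemma actZE r y m : act (tn r * y) m = r *: act y m.
Proof. by rewrite actZ. Qed.

Lemma act_tnE r m : act (tn r) m = r *: m.
Proof. by rewrite [act _]action_to_normalization. Qed.

(* [M_p] embeds in a free module over the center of the hereditary ring
   [End M_p]; the [End M_p]-span of this submodule is projective, and by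
   [generator_at] the center splits off [End M_p] as a module. *)
Lemma local_dual_basis (p : Spec R) :
  (forall X : lmodType (alg_at p (End_alg M)), proj_dim_le X 1) ->
  exists2 t, ~ (p : set R) t & exists sigma : 'I_l -> M -> S,
    (forall j, semilinear (sigma j)) /\
    forall m, t *: m = \sum_j act (sigma j m) (x j).
Proof.
move=> gld; have [s ps [nu [nu_lin nu_x]]] := generator_at gld.
(* Row j is the image of [x j] under the map to R^l with components [lam i]; applying [lam i] to the
   dual basis relation gives Y Y = d Y. *)
pose Y : 'M[End M]_l := \matrix_(j, i) homothety M (lam i (x j)).
have [|s' ps' [E [EY dE]]] := local_splitting (d := d) (Y := Y) (W := 1%:M) gld.
  apply/matrixP => j i; apply: HomP => y.
  rewrite mulmx1 homothety_mxE End_mulmxE mxE.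
  have -> : homothety M (lam i (x j)) y = (lam i (x j) : R) *: y by [].
  rewrite scalerA -[d * _]/(d *: (lam i (x j))) -linearZ/= d_lam linear_sum scaler_suml.
  apply: eq_bigr => a _; rewrite !mxE [lam i (_ *: _)]linearZ.
  by rewrite -[RHS]/(((lam a (x j) : R) * (lam i (x a) : R)) *: y) -scalerA.
(* The map splitting the center off End M at p: it sends a scalar r to r s, with s outside p. *)
pose tr (f : End M) : S := \sum_c nu c (f (x c)).
have tr_lin : semilinear tr.
  move=> r f g; rewrite /tr mulr_sumr -big_split/=; apply: eq_bigr => c _.
  exact: nu_lin.
pose T j a := tr (E j a).
have dT j a : tn d * T j a = \sum_b tn (lam b (x j)) * T b a.
  rewrite -semilinearZ//.
  have -> : d *: E j a = \sum_b (lam b (x j) : R) *: E b a.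
    rewrite -homothetyE; have := congr1 (fun X : 'M[End M]_l => X j a) dE.
    rewrite [LHS]mxE => ->; rewrite mulmx1 mxE; apply: eq_bigr => b _.
    by rewrite mxE homothetyE.
  by rewrite semilinear_sum//; apply: eq_bigr => b _; rewrite semilinearZ.
have TY j i : \sum_a tn (lam i (x a)) * T j a = tn (s * s' * (lam i (x j) : R)).
  transitivity (tr ((s' * (lam i (x j) : R)) *: (1 : End M))).
    have -> : (s' * (lam i (x j) : R)) *: (1 : End M) = \sum_a (lam i (x a) : R) *: E j a.
      have := congr1 (fun X : 'M[End M]_l => X j i) EY.
      rewrite [RHS]mxE [in RHS]mxE homothetyE /homothety scalerA => <-.
      rewrite mxE; apply: eq_bigr => a _.
      by rewrite mxE -homothetyC homothetyE.
    by rewrite semilinear_sum//; apply: eq_bigr => a _; rewrite semilinearZ.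
  rewrite semilinearZ// /tr -/S.
  have -> : \sum_c nu c ((1 : End M) (x c)) = tn s by exact: nu_x.
  by rewrite -rmorphM; congr (tn _); ring.
(* The functional is [m] read through the [lam b] and the matrix [T], divided by d. The division is
   possible since [dT] gives sigma_a(x_j) = T_ja on the generators. *)
have ex_sigma a : exists sigma : M -> S, semilinear sigma /\
    forall m, \sum_b tn (lam b m) * T b a = tn d * sigma m.
  have [||sigma sl sE] := @semilinear_division d (fun m => \sum_b tn (lam b m) * T b a) d_reg.
  - move=> r m n; rewrite mulr_sumr -big_split/=; apply: eq_bigr => b _.
    by rewrite linearP mulrA -mulrDl -rmorphM -rmorphD.
  - move=> m; have [c ->] := x_gen m; exists (\sum_j tn (c j) * T j a).
    rewrite mulr_sumr.
    under [in RHS]eq_bigr do rewrite mulrCA dT mulr_sumr.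
    rewrite exchange_big/=; apply: eq_bigr => b _.
    rewrite linear_sum rmorph_sum mulr_suml; apply: eq_bigr => j _.
    by rewrite linearZ mulrA -rmorphM.
  by exists sigma.
have [sigma sigmaP] := choice ex_sigma.
exists (s * s'); first by case/prime_mul.
exists sigma; split=> [a|m]; first exact: (sigmaP a).1.
have actT b : \sum_a act (T b a) (x a) = (s * s') *: x b.
  apply: (torsion_free_regI d_reg); rewrite scaler_sumr.
  transitivity (\sum_a \sum_i act (tn (lam i (x a)) * T b a) (x i)).
    apply: eq_bigr => a _; rewrite -linearZ/= d_lam linear_sum.
    by apply: eq_bigr => i _; rewrite linearZ_LR actZE.
  rewrite exchange_big scalerA mulrC -scalerA d_lam scaler_sumr; apply: eq_bigr => i _.
  by rewrite -act_sumE TY act_tnE scalerA.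
apply: (torsion_free_regI d_reg); rewrite scalerA mulrC -scalerA d_lam !scaler_sumr.
transitivity (\sum_b \sum_a act (tn (lam b m) * T b a) (x a)).
  apply: eq_bigr => b _; rewrite scalerA mulrC -scalerA -actT scaler_sumr.
  by apply: eq_bigr => a _; rewrite actZE.
rewrite exchange_big; apply: eq_bigr => a _.
by rewrite -act_sumE (sigmaP a).2 actZE.
Qed.
End LocalDualBasis.

(** * The map to the endomorphisms of the reflexive extension *)

Section BidualMap.
Variables (R : comPzRingType) (M : lmodType R).
Let S := normalization R.
Let tn : {rmorphism R -> S} := @to_normalization R.
Let T : lmodType S := base_change tn M.
Let F : lmodType S := reflexive_extension M.
Local Notation tens m c := (tens tn m c : T).

Lemma tensE (m : M) (c : S) : tens m c = c *: tens m 1.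
Proof. by rewrite -[RHS]/(tens_scale _ _) tens_scaleE /= mulr1. Qed.

Lemma tens_linear r (m n : M) : tens (r *: m + n) 1 = tn r *: tens m 1 + tens n 1.
Proof.
rewrite -tensE; transitivity (tens (r *: m) 1 + tens n 1).
  by rewrite [RHS]tens_addE; apply/tsumP/tensor_addl.
congr (_ + _); apply/tsumP; have := tensor_scale tn r m 1.
by rewrite mulr1.
Qed.

Lemma tsum_cons (m : M) (c : S) s : tsum tn ((m, c) :: s) = c *: tens m 1 + tsum tn s.
Proof. by rewrite -tensE [RHS]tens_addE. Qed.

Lemma dual_semilinear (lam : dual T) : semilinear (fun m => lam (tens m 1)).
Proof. by move=> r m n; rewrite tens_linear linearP. Qed.

Lemma dual_base_changeP (lam mu : dual T) :
  (forall m, lam (tens m 1) = mu (tens m 1)) -> lam = mu.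
Proof.
move=> e; apply: HomP; apply: tsumW; elim=> [|[m c] s IH].
  by rewrite -[tsum tn [::]]/(0 : T) !linear0.
by rewrite tsum_cons !linearP e IH.
Qed.

Lemma dual_base_change_exists (theta : M -> S) : semilinear theta ->
  exists lam : dual T, forall m, lam (tens m 1) = theta m.
Proof.
move=> th; pose L (s : seq (M * S)) : S := \sum_(p <- s) p.2 * theta p.1.
have LE s t : tensor_rel tn s t -> L s = L t.
  elim=> {s t} //.
  - by move=> s t u _ -> _ ->.
  - by move=> s s' t t' _ e _ e'; rewrite /L !big_cat /= -/(L _) e -/(L _) e'.
  - by move=> s t; rewrite /L !big_cat/= addrC.
  - by move=> c; rewrite /L big_seq1 big_nil (semilinear0 th) mulr0.
  - by move=> m n c; rewrite /L big_seq1 big_cons big_seq1 (semilinearD th) mulrDr.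
  - by move=> m c e; rewrite /L big_seq1 big_cons big_seq1 mulrDl.
  - by move=> r m c; rewrite /L !big_seq1 (semilinearZ th) /= mulrA [c * _]mulrC.
have LT s : L (repr (tsum tn s)) = L s by apply/LE/tsumP; exact: tsum_repr.
have L_lin : linear (fun y : T => L (repr y) : S^o).
  move=> c y z; move: y z; apply: tsumW => s; apply: tsumW => t.
  have -> : c *: tsum tn s + tsum tn t = tsum tn (scalel c s ++ t).
    by rewrite -[LHS]/(tens_add (tens_scale _ _) _) tens_scaleE tens_addE.
  rewrite !LT /L big_cat big_map; congr (_ + _).
  rewrite [RHS]mulr_sumr; apply: eq_bigr => q _; exact: esym (mulrA _ _ _).
have [lam lamE] : exists lam : dual T, lam =1 _ := linear_function_exists L_lin.
by exists lam => m; rewrite lamE LT /L big_seq1 mul1r.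
Qed.

Lemma dual_base_change_family k (sigma : 'I_k -> M -> S) :
  (forall j, semilinear (sigma j)) ->
  exists tau : 'I_k -> dual T, forall j m, tau j (tens m 1) = sigma j m.
Proof.
move=> sl; have [tau tauE] := choice (fun j => dual_base_change_exists (sl j)).
by exists tau.
Qed.

Lemma pullback_exists (f : End M) (lam : dual T) :
  exists mu : dual T, forall m, mu (tens m 1) = lam (tens (f m) 1).
Proof.
apply: dual_base_change_exists => r m n.
by rewrite linearP (dual_semilinear lam).
Qed.

(** The transpose of the base change of [f]; the transpose of this map is [bidual f], so the order
    of composition is restored. *)
Definition pullback f lam : dual T := sval (cid (pullback_exists f lam)).

Lemma pullbackE f lam m : pullback f lam (tens m 1) = lam (tens (f m) 1).
Proof. by rewrite /pullback; case: cid. Qed.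

Definition bidual_fun (f : End M) (xi : F) (lam : dual T) : S^o :=
  xi (pullback f lam).

Lemma bidual_fun_linear f xi : linear (bidual_fun f xi).
Proof.
move=> c lam mu; rewrite /bidual_fun -linearP; congr (xi _).
by apply: dual_base_changeP => m; rewrite /= !pullbackE.
Qed.
HB.instance Definition _ f xi := GRing.isLinear.Build S (dual T) S^o *:%R
  (bidual_fun f xi) (bidual_fun_linear f xi).

Definition bidual (f : End M) (xi : F) : F :=
  (bidual_fun f xi : {linear dual T -> S^o}).

Lemma bidual_linear f : linear (bidual f).
Proof. by move=> c xi zeta; apply: HomP. Qed.
HB.instance Definition _ f := GRing.isLinear.Build S F F *:%R
  (bidual f) (bidual_linear f).

Definition bidual_End (f : End M) : End F := (bidual f : {linear F -> F}).

Lemma bidual_EndE f (xi : F) (lam : dual T) :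
  (bidual_End f xi : F) lam = xi (pullback f lam).
Proof. by []. Qed.

Lemma bidual_End_semilinear r f g :
  bidual_End (r *: f + g) = tn r *: bidual_End f + bidual_End g.
Proof.
apply: HomP => xi; apply: HomP => lam.
rewrite -[RHS]/(tn r *: (xi (pullback f lam)) + xi (pullback g lam)).
rewrite bidual_EndE -linearP; congr (xi _); apply: dual_base_changeP => m.
by rewrite /= !pullbackE (dual_semilinear lam).
Qed.

Lemma bidual_End_zmod : zmod_morphism bidual_End.
Proof.
move=> f g; rewrite addrC -scaleN1r bidual_End_semilinear rmorphN rmorph1.
by rewrite scaleN1r addrC.
Qed.

Lemma bidual_End_monoid : monoid_morphism bidual_End.
Proof.
split=> [|f g]; apply: HomP => xi; apply: HomP => lam; rewrite bidual_EndE.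
  rewrite -[RHS]/(xi lam); congr (xi _); apply: dual_base_changeP => m.
  by rewrite pullbackE.
rewrite -[RHS]/(xi (pullback g (pullback f lam))); congr (xi _).
by apply: dual_base_changeP => m; rewrite !pullbackE.
Qed.

HB.instance Definition _ := GRing.isZmodMorphism.Build (End M) (End F)
  bidual_End bidual_End_zmod.
HB.instance Definition _ := GRing.isMonoidMorphism.Build (End M) (End F)
  bidual_End bidual_End_monoid.

Lemma bidual_EndZ r f : bidual_End (r *: f) = tn r *: bidual_End f.
Proof. by rewrite -[r *: f]addr0 bidual_End_semilinear rmorph0 addr0. Qed.

Lemma eval_exists m : exists xi : F, forall lam : dual T, xi lam = lam (tens m 1).
Proof.
have ev_lin : linear (fun lam : dual T => lam (tens m 1) : S^o) by [].
have [xi xiE] : exists xi : F, xi =1 _ := linear_function_exists ev_lin.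
by exists xi.
Qed.

Definition eval m : F := sval (cid (eval_exists m)).

Lemma evalE m lam : eval m lam = lam (tens m 1).
Proof. by rewrite /eval; case: cid => xi xiE; exact: xiE. Qed.

Lemma eval_semilinear r m n : eval (r *: m + n) = tn r *: eval m + eval n.
Proof.
apply: HomP => lam; rewrite -[RHS]/(tn r *: eval m lam + eval n lam).
by rewrite !evalE (dual_semilinear lam).
Qed.
End BidualMap.

(** * Bijectivity of the map *)

Section Comparison.
Variables (R : comPzRingType) (M : lmodType R).
Hypotheses (R_noetherian : noetherian R) (R_reduced : reduced R).
Hypotheses (M_fg : finitely_generated M) (M_faithful : faithful M).
Hypothesis M_torsion_free : torsion_free M.
Hypothesis M_nonsingular : nonsingular_order (End_alg M).

Let S := normalization R.
Let tn : {rmorphism R -> S} := @to_normalization R.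
Let T : lmodType S := base_change tn M.
Let F : lmodType S := reflexive_extension M.
Local Notation tens m := (tens tn m 1 : T).
Local Notation act := (action R_noetherian M_torsion_free M_nonsingular).

Local Notation ev := (@eval R M).

Definition combine l (x : 'I_l -> M) (sigma : 'I_l -> dual T) (xi : F) : M :=
  \sum_j act (xi (sigma j)) (x j).

Lemma dual_act (mu : dual T) (y : S) m : mu (tens (act y m)) = y * mu (tens m).
Proof.
exact: (@semilinear_action _ _ _ _ _ (fun m => mu (tens m)) y m (dual_semilinear mu)).
Qed.

(** Applying mu to the relation for t gives t mu as the combination of the [sigma j] with
    coefficients mu(x_j), so t xi is determined by the values of xi on the [sigma j]. Thus [combine]
    inverts [eval] up to the factor t. *)
Lemma combine_eval l (x : 'I_l -> M) (sigma : 'I_l -> dual T) (t : R) :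
  (forall m, t *: m = \sum_j act (sigma j (tens m)) (x j)) ->
  forall xi : F, tn t *: xi = ev (combine x sigma xi).
Proof.
move=> t_sigma xi; apply: HomP => mu; rewrite evalE.
have mu_lin := dual_semilinear mu.
rewrite /combine (semilinear_sum mu_lin) -[LHS]/(tn t * xi mu).
under eq_bigr do rewrite dual_act.
have -> : tn t * xi mu = xi (tn t *: mu) by rewrite linearZ.
have -> : tn t *: mu = \sum_j mu (tens (x j)) *: sigma j.
  apply: dual_base_changeP => m; rewrite hom_sumE -[LHS]/(tn t * mu (tens m)).
  rewrite -(semilinearZ mu_lin) t_sigma (semilinear_sum mu_lin).
  by apply: eq_bigr => j _; rewrite dual_act mulrC.
by rewrite linear_sum; apply: eq_bigr => j _; rewrite linearZ mulrC.
Qed.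

Lemma combine_semilinear l (x : 'I_l -> M) (sigma : 'I_l -> dual T) r xi zeta :
  combine x sigma (tn r *: xi + zeta) = r *: combine x sigma xi + combine x sigma zeta.
Proof.
rewrite /combine scaler_sumr -big_split/=; apply: eq_bigr => j _.
transitivity (act (tn r * xi (sigma j) + zeta (sigma j)) (x j)); first by [].
by rewrite actionP.
Qed.

Lemma combine_End l (x : 'I_l -> M) (sigma : 'I_l -> dual T) (psi : End F) :
  exists g : End M, forall m, g m = combine x sigma (psi (ev m)).
Proof.
apply: linear_function_exists => r m n.
by rewrite eval_semilinear [psi _]linearP combine_semilinear.
Qed.

Lemma bidual_End_eval f m : bidual_End f (ev m) = ev (f m).
Proof. by apply: HomP => lam; rewrite bidual_EndE !evalE pullbackE. Qed.

Lemma reflexive_extension_regI b (xi zeta : F) :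
  nonzerodivisor b -> tn b *: xi = tn b *: zeta -> xi = zeta.
Proof.
move=> br e; apply: HomP => lam; apply: (to_normalization_regI br).
by rewrite -[LHS]/((tn b *: xi) lam) e.
Qed.

Section GlobalDualBasis.
Variables (l : nat) (x : 'I_l -> M) (d : R) (lam : 'I_l -> Hom M R^o).
Hypothesis x_gen : forall m, exists a : 'I_l -> R, m = \sum_(j < l) a j *: x j.
Hypothesis d_reg : nonzerodivisor d.
Hypothesis d_lam : forall m, d *: m = \sum_(j < l) (lam j m : R) *: x j.

(** The [lam j] extend to the base change, so the image of m determines the [lam j m], and these
    determine d m. *)
Lemma eval_inj : injective ev.
Proof.
move=> m n emn; apply: (torsion_free_regI M_torsion_free d_reg).
rewrite !d_lam; apply: eq_bigr => j _; congr (_ *: _).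
apply: (@to_normalization_inj R).
have [|mu muE] := @dual_base_change_exists R M (fun m => tn (lam j m)).
  by move=> r u v; rewrite linearP rmorphD rmorphM.
by rewrite -/tn -!muE -!evalE emn.
Qed.

Lemma bidual_End_inj : injective (@bidual_End R M).
Proof.
move=> f g e; apply: HomP => m; apply: eval_inj.
by rewrite -!bidual_End_eval e.
Qed.

(** By the generic dual basis d psi restricts to an endomorphism g of M. At the primes tested by
    [End_divisible] the local dual basis makes t psi restrict to M as well, with t outside p, so g
    is divisible by d there; the quotient g / d is the preimage. *)
Lemma bidual_End_surj (psi : End F) : exists f : End M, bidual_End f = psi.
Proof.
have [lam' lam'E] : exists lam' : 'I_l -> dual T, forall j m, lam' j (tens m) = tn (lam j m).
  apply: (dual_base_change_family (sigma := fun j m => tn (lam j m))) => j r u v.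
  by rewrite linearP rmorphD rmorphM.
have evd xi : tn d *: xi = ev (combine x lam' xi).
  apply: combine_eval => m; rewrite d_lam; apply: eq_bigr => j _.
  by rewrite lam'E act_tnE.
have [g gE] := combine_End x lam' psi.
have [p gld|f gf] := @End_divisible R M R_noetherian M_torsion_free M_nonsingular d g d_reg.
  have [t pt [sigma [sl t_sigma]]] := local_dual_basis R_noetherian R_reduced
    M_faithful M_torsion_free M_nonsingular x_gen d_reg d_lam gld.
  exists t => //; have [tau tauE] := dual_base_change_family sl.
  have evt xi : tn t *: xi = ev (combine x tau xi).
    apply: combine_eval => m; rewrite t_sigma; apply: eq_bigr => j _.
    by rewrite tauE.
  have [h hE] := combine_End x tau psi.
  (* Both t g and d h become t d psi after [eval]. *)
  exists h; apply: HomP => m; apply: eval_inj.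
  have evZ r n : ev (r *: n) = tn r *: ev n :> F.
    apply: HomP => mu; rewrite -[RHS]/(tn r * ev n mu) !evalE.
    exact: semilinearZ (dual_semilinear mu) _ _.
  rewrite -[(t *: g) m]/(t *: g m) -[(d *: h) m]/(d *: h m) !evZ gE hE -evd -evt.
  by rewrite !scalerA mulrC.
(* The factor d is used twice: first to replace xi by the image of an element n of M, then to
   compare f n with psi at that image. *)
exists f; apply: HomP => xi; apply: (reflexive_extension_regI d_reg).
rewrite -!linearZ/= evd bidual_End_eval; set n := combine _ _ _.
apply: (reflexive_extension_regI d_reg); rewrite [RHS]evd -gE gf.
apply: HomP => mu; rewrite -[LHS]/(tn d * ev (f n) mu) !evalE.
by rewrite -(semilinearZ (dual_semilinear mu)).
Qed.
End GlobalDualBasis.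

Lemma bidual_End_bij : bijective (@bidual_End R M).
Proof.
have [l [x x_gen]] := M_fg.
have [d [lam [dr dl]]] := generic_dual_basis R_noetherian R_reduced x_gen.
have [inv invE] := choice (bidual_End_surj x_gen dr dl).
by exists inv => // f; apply: (bidual_End_inj dr dl).
Qed.
End Comparison.

Theorem proposition2p21 (R : comPzRingType) (M : lmodType R)
    (R_noetherian : noetherian R) (R_reduced : reduced R)
    (M_fg : finitely_generated M) (M_faithful : faithful M)
    (M_torsion_free : torsion_free M) (M_NCCR : gives_NCCR M) :
  exists phi : {rmorphism End M -> End (reflexive_extension M)},
    bijective phi /\
    forall (r : R) (f : End M), phi (r *: f) = to_normalization r *: phi f.
Proof.
case: M_NCCR => _ _ _ M_nonsingular; exists (@bidual_End R M : {rmorphism _ -> _}).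
split=> [|r f]; first exact: bidual_End_bij.
exact: bidual_EndZ.
Qed.
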